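(* Let $(M,g)$ be an $n$-dimensional Riemannian manifold with Levi--Civita connection $\nabla$, let $\mu$ be a smooth function on $M$ with $g$-gradient $\nabla\mu$, and let $\tilde g=e^{2\mu}g$. Let $\sigma$ be a $p$-dimensional distribution on $M$ with orthogonal complement $\sigma^{\bot}$ of dimension $q=n-p$. Let $\tau^V(\sigma)$ and $\tilde\tau^V(\sigma)$ be the vertical tension fields of $\sigma$ with respect to $g$ and $\tilde g$. Then for all $X\in\sigma$ and $Y\in\sigma^{\bot}$ $$\begin{aligned} e^{2\mu}\,\tilde\tau^V(\sigma)(X,Y)=\ &\tau^V(\sigma)(X,Y)+(p-q)\,g(\nabla\mu,X)\,g(\nabla\mu,Y)\\ &-2g(\nabla\mu,X)\,g(H_{\sigma},Y)+2g(\nabla\mu,Y)\,g(H_{\sigma^{\bot}},X)\\ &-2g(\nabla_Y(\nabla\mu)^{\bot},X)+2g(\nabla_X(\nabla\mu)^{\top},Y)\\ &+(n-2)\,g(\nabla_{\nabla\mu}X,Y), \end{aligned}$$ where $\tau^V(\sigma)(X,Y)=g(\tau^V(\sigma)(X),Y)$ and $\tilde\tau^V(\sigma)(X,Y)=g(\tilde\tau^V(\sigma)(X),Y)$.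
   Context: $\top$ and $\bot$ denote the orthogonal projections onto $\sigma$ and $\sigma^{\bot}$ (the same for $g$ and $\tilde g$). In $g(\nabla_{\nabla\mu}X,Y)$ the vector $X$ is extended to a local section of $\sigma$ (the value does not depend on the extension). Mean curvature (with respect to $g$): $H_{\sigma}=\sum_{a}(\nabla_{e_a}e_a)^{\bot}$ for a local $g$-orthonormal frame $(e_a)$ of $\sigma$, and $H_{\sigma^{\bot}}=\sum_j(\nabla_{e_j}e_j)^{\top}$ for a local $g$-orthonormal frame $(e_j)$ of $\sigma^{\bot}$. Vertical tension field. For a Riemannian metric $h$ on $M$ with Levi--Civita connection $D$, and a distribution $\sigma$ with $h$-orthogonal complement $\sigma^{\bot}$, the vertical tension field of $\sigma$ with respect to $h$ assigns to a section $X$ of $\sigma$ the section of $\sigma^{\bot}$ $$\sum_{\alpha}\Big((D^2X)(E_{\alpha},E_{\alpha})-2D_{E_{\alpha}}(D_{E_{\alpha}}X)^{\top}\Big)^{\bot},\qquad (D^2X)(E,E)=D_ED_EX-D_{D_EE}X,$$ where $(E_\alpha)$ is a local $h$-orthonormal frame on $M$; it is tensorial in $X$ and independent of the frame. Here $\tau^V(\sigma)(X)$ denotes this for $h=g$ and $\tilde\tau^V(\sigma)(X)$ for $h=\tilde g$. *)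

(* Defs.v *)
From mathcomp Require Import all_boot all_order all_algebra.
From mathcomp Require Import all_classical all_reals all_analysis.

Set Implicit Arguments.
Unset Strict Implicit.
Unset Printing Implicit Defensive.

Import Order.TTheory GRing.Theory Num.Theory.
Import numFieldNormedType.Exports.

Local Open Scope classical_set_scope.
Local Open Scope ring_scope.

Section EuclideanSmoothness.
Context {R : realType} {n : nat}.

Definition partial_derivative (i : 'I_n) (f : 'rV[R]_n -> R) : 'rV[R]_n -> R :=
  fun u => 'D_(delta_mx 0 i) f u.

(* C^oo on an open set A: every iterated partial derivative exists and is
   (Frechet) differentiable at every point of A. *)
Definition euclidean_smooth (A : set 'rV[R]_n) (f : 'rV[R]_n -> R) : Prop :=
  forall (s : seq 'I_n) (u : 'rV[R]_n), A u ->
    differentiable (foldr partial_derivative f s) u.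

End EuclideanSmoothness.

Record chart (R : realType) (n : nat) (M : topologicalType) := Chart {
  chart_dom : set M;
  chart_map : M -> 'rV[R]_n;
  chart_inv : 'rV[R]_n -> M;
  chart_dom_open : open chart_dom;
  chart_codom_open : open (chart_map @` chart_dom);
  chart_mapK : {in chart_dom, cancel chart_map chart_inv};
  chart_map_continuous : {within chart_dom, continuous chart_map};
  chart_inv_continuous :
    {within chart_map @` chart_dom, continuous chart_inv} }.

(* The atlas need not be maximal. *)
Record smooth_manifold (R : realType) (n : nat) := SmoothManifold {
  carrier :> topologicalType;
  carrier_hausdorff : hausdorff_space carrier;
  carrier_second_countable : @second_countable carrier;
  atlas : set (chart R n carrier);
  atlas_cover : forall x : carrier, exists2 c, atlas c & chart_dom c x;
  atlas_smooth : forall c d : chart R n carrier, atlas c -> atlas d ->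
    forall i : 'I_n,
      euclidean_smooth (chart_map c @` (chart_dom c `&` chart_dom d))
        (fun u => chart_map d (chart_inv c u) 0 i) }.

Section Manifold.
Context {R : realType} {n : nat} (M : smooth_manifold R n).

Definition smooth_on (U : set M) (f : M -> R) : Prop :=
  forall c : chart R n M, atlas c ->
    euclidean_smooth (chart_map c @` (U `&` chart_dom c)) (f \o chart_inv c).

Definition smooth_at (x : M) (f : M -> R) : Prop :=
  exists2 U : set M, open_nbhs x U & smooth_on U f.

(* Tangent vectors at x are represented by the operators they induce on
   functions smooth near x.  Each such operator is extended by 0 to all other
   functions, so that equal tangent vectors are Leibniz-equal and the vector
   space operations are the pointwise ones of the function space. *)
Definition vec : Type := (M -> R) -> R.

Definition tangent (x : M) : set vec :=
  [set v | exists c : chart R n M, [/\ atlas c, chart_dom c x &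
     exists w : 'rV[R]_n, v = fun f =>
       if `[< smooth_at x f >]
       then 'D_w (f \o chart_inv c) (chart_map c x) else 0]].

(* Local vector fields are total functions that are only meaningful on the
   open set on which they are required to be smooth. *)
Definition vfield : Type := M -> vec.

Definition vector_field (U : set M) (X : vfield) : Prop :=
  (forall x, U x -> tangent x (X x)) /\
  (forall (V : set M) (f : M -> R), open V -> V `<=` U -> smooth_on V f ->
     smooth_on V (fun x => X x f)).

Definition tensor2 : Type := M -> vec -> vec -> R.

Record riemannian_metric (g : tensor2) : Prop := RiemannianMetric {
  metric_sym : forall x u v, tangent x u -> tangent x v -> g x u v = g x v u;
  metric_linear : forall x (a : R) u v w,
    tangent x u -> tangent x v -> tangent x w ->
    g x (a *: u + v) w = a * g x u w + g x v w;
  metric_pos : forall x v, tangent x v -> v != 0 -> 0 < g x v v;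
  metric_smooth : forall (U : set M) (X Y : vfield), open U ->
    vector_field U X -> vector_field U Y ->
    smooth_on U (fun x => g x (X x) (Y x)) }.

(* D x v Y is the covariant derivative at x of Y in the direction v. *)
Definition connection : Type := forall x : M, vec -> vfield -> vec.

Record levi_civita (g : tensor2) (D : connection) : Prop := LeviCivita {
  lc_smooth : forall (U : set M) (X Y : vfield), open U ->
    vector_field U X -> vector_field U Y ->
    vector_field U (fun x => D x (X x) Y);
  lc_linear : forall (U : set M) (Y : vfield) x (a : R) u v, open U -> U x ->
    vector_field U Y -> tangent x u -> tangent x v ->
    D x (a *: u + v) Y = a *: D x u Y + D x v Y;
  lc_additive : forall (U : set M) (Y Z : vfield) x v, open U -> U x ->
    vector_field U Y -> vector_field U Z -> tangent x v ->
    D x v (fun y => Y y + Z y) = D x v Y + D x v Z;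
  lc_leibniz : forall (U : set M) (f : M -> R) (Y : vfield) x v,
    open U -> U x -> smooth_on U f -> vector_field U Y -> tangent x v ->
    D x v (fun y => f y *: Y y) = v f *: Y x + f x *: D x v Y;
  lc_metric : forall (U : set M) (Y Z : vfield) x v, open U -> U x ->
    vector_field U Y -> vector_field U Z -> tangent x v ->
    v (fun y => g y (Y y) (Z y)) = g x (D x v Y) (Z x) + g x (Y x) (D x v Z);
  lc_torsion_free : forall (U : set M) (X Y : vfield) (f : M -> R) x,
    open U -> U x -> vector_field U X -> vector_field U Y -> smooth_on U f ->
    (D x (X x) Y - D x (Y x) X) f =
    X x (fun y => Y y f) - Y x (fun y => X y f) }.

Definition gradient (g : tensor2) (mu : M -> R) : vfield :=
  fun x => xget 0 [set w : vec | tangent x w /\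
                     forall v, tangent x v -> g x w v = v mu].

Definition conformal_metric (mu : M -> R) (g : tensor2) : tensor2 :=
  fun x u v => expR (2 * mu x) * g x u v.

Definition lin_span {k : nat} (b : 'I_k -> vec) : set vec :=
  [set v | exists c : 'I_k -> R, v = \sum_(i < k) c i *: b i].

Definition lin_indep {k : nat} (b : 'I_k -> vec) : Prop :=
  forall c : 'I_k -> R, \sum_(i < k) c i *: b i = 0 -> forall i, c i = 0.

Definition smooth_distribution (p : nat) (S : M -> set vec) : Prop :=
  forall x : M, exists (U : set M) (b : 'I_p -> vfield),
    [/\ open_nbhs x U, forall i, vector_field U (b i) &
        forall y, U y -> lin_indep (b ^~ y) /\ S y = lin_span (b ^~ y)].

Definition perp (g : tensor2) (S : M -> set vec) : M -> set vec :=
  fun x => [set v | tangent x v /\ forall w, S x w -> g x w v = 0].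

Definition ortho_proj (g : tensor2) (S : M -> set vec) (x : M) (v : vec) : vec :=
  xget 0 [set w : vec | S x w /\ perp g S x (v - w)].

Definition section_of (S : M -> set vec) (U : set M) (X : vfield) : Prop :=
  vector_field U X /\ forall x, U x -> S x (X x).

Definition orthonormal_frame (g : tensor2) (S : M -> set vec) (U : set M)
    {k : nat} (e : 'I_k -> vfield) : Prop :=
  (forall i, section_of S U (e i)) /\
  forall x, U x ->
    (forall i j, g x (e i x) (e j x) = (i == j)%:R) /\
    S x `<=` lin_span (e ^~ x).

(* Mean curvature of the distribution with local orthonormal frame e; S is the
   orthogonal complement of that distribution. *)
Definition mean_curvature (g : tensor2) (D : connection) (S : M -> set vec)
    {k : nat} (e : 'I_k -> vfield) : vfield :=
  fun x => \sum_(i < k) ortho_proj g S x (D x (e i x) (e i)).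

Definition second_derivative (D : connection) (X E : vfield) : vfield :=
  fun x => D x (E x) (fun y => D y (E y) X) - D x (D x (E x) E) X.

(* Computed with a local orthonormal frame E of the tangent bundle. *)
Definition vertical_tension (h : tensor2) (D : connection) (S : M -> set vec)
    (E : 'I_n -> vfield) (X : vfield) : vfield :=
  fun x => ortho_proj h (perp h S) x
    (\sum_(i < n) (second_derivative D X (E i) x
       - 2 *: D x (E i x) (fun y => ortho_proj h S y (D y (E i y) X)))).

End Manifold.

(* Main.v *)
(* The Koszul argument gives nablat_v B = nabla_v B + v(mu) B + B(mu) v - g(v,B) N
   with N the gradient of mu.  After pairing with Y in the complement, the
   summand of the tension field at a frame vector is a tensor T(A,A), so its
   trace may be taken in any frame: choose the g-orthonormal frame adapted to
   sigma and its complement, at the cost of a factor exp(-2 mu) for the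
   conformal metric.  Expanding T for the conformal connection on each adapted
   vector and summing leaves the stated terms together with
   Y(X(mu)) + (nabla_Y X)(mu) - 2 (nabla_Y X)^top(mu) - g(nabla_X N, Y), which is
   -2 g(nabla_Y N^bot, X) by symmetry of the Hessian of mu and
   g(N^bot, X) = 0. *)
Require Import Defs.
From mathcomp Require Import all_boot all_order all_algebra.
From mathcomp Require Import all_classical all_reals all_analysis.
From mathcomp Require Import ring lra.
Set Implicit Arguments.
Unset Strict Implicit.
Unset Printing Implicit Defensive.
Import Order.TTheory GRing.Theory Num.Theory.
Import numFieldNormedType.Exports.
Local Open Scope classical_set_scope.
Local Open Scope ring_scope.

(** * Smooth functions on open subsets of the model space *)

(** A connection here acts on total functions that are constrained only on an open set, and neither
    its locality nor the tensoriality of the summand is given. All computations therefore live over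
    one open set [U] carrying the frames: vectors at a point are extended over [U] by freezing their
    frame coefficients, and identities valid on [U] alone enter derivatives through a locality lemma
    deduced from the Leibniz rule. The diagonal [T(A, A)] cannot be expanded in another frame
    directly, so it is polarised to [T(a, B)], with [a] a vector at [x] and [B] a field: the first
    slot is differentiated along, the second is differentiated. In this form [Y] is only paired
    with, so it stays a vector at [x]. Projections are the same for both metrics, so the conformal
    tension form is also paired with [g]; the conformal factor then enters once, through the frame
    relation of the second orthonormal frame. *)

Section EuclideanCalculus.
Context {R : realType} {n : nat}.
Implicit Types (A B : set 'rV[R]_n) (f h : 'rV[R]_n -> R).

(** The first-order expansion of [f] at [a] is also one of [h], with the same linear part, because a
    little-o estimate only sees points near [a]. *)
Lemma near_eq_differentiable (f h : 'rV[R]_n -> R) (a : 'rV[R]_n) :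
  (\near a, f a = h a) -> differentiable f a -> differentiable h a.
Proof.
move=> fh /diff_locallyP[cdf fE].
have hE : h \o shift a = cst (h a) + 'd f a +o_ (0 : 'rV[R]_n) id.
  apply/eqaddoP => e e0.
  move/eqaddoP : fE => /(_ e e0) fE.
  have fh0 : \forall z \near (0 : 'rV[R]_n), f (z + a) = h (z + a).
    by move: fh; rewrite (near_shift 0 a) subr0.
  near=> z.
  have fz : f (z + a) = h (z + a) by near: z.
  rewrite -[_ z]/(h (z + a) - _) -fz -(nbhs_singleton fh); near: z; exact: fE.
have dh : 'd h a = 'd f a :> ('rV[R]_n -> R) by apply: diff_unique.
by apply/diff_locallyP; rewrite dh.
Unshelve. all: by end_near. Qed.

(* Finite order is what makes inductions go through: the product and chain
   rules lower the order by one. *)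
Definition differentiable_upto (k : nat) A f :=
  forall (s : seq 'I_n), (size s <= k)%N ->
    forall u, A u -> differentiable (foldr partial_derivative f s) u.

Lemma euclidean_smoothE A f :
  euclidean_smooth A f <-> forall k, differentiable_upto k A f.
Proof. by split=> [Af k s _|Af s]; [exact: Af|exact: (Af (size s))]. Qed.

Lemma differentiable_upto0 A f :
  differentiable_upto 0 A f <-> forall u, A u -> differentiable f u.
Proof.
by split=> [Af|Af s]; [exact: (Af [::])|rewrite leqn0 => /nilP ->].
Qed.

(** [foldr] applies the last index of the list first; removing it there leaves a shorter list acting
    on [partial_derivative i f]. *)
Lemma differentiable_uptoS k A f :
  differentiable_upto k.+1 A f <->
  (forall u, A u -> differentiable f u) /\
  (forall i, differentiable_upto k A (partial_derivative i f)).
Proof.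
split=> [Af|[Af dAf] s].
  split=> [|i s sk u Au]; first exact: (Af [::]).
  have := Af (rcons s i); rewrite size_rcons foldr_rcons; exact.
case/lastP: s => [_|s i]; first exact: Af.
by rewrite size_rcons ltnS foldr_rcons; exact: dAf.
Qed.

Lemma differentiable_uptoW k A f :
  differentiable_upto k.+1 A f -> differentiable_upto k A f.
Proof. by move=> Af s sk; apply: Af; exact: leqW. Qed.

(** On an open set, pointwise agreement is agreement near each point, so it passes to partial
    derivatives. The rules below use it to replace a derivative by a formula known on [A] only. *)
Lemma differentiable_upto_eq k A f h : open A ->
  (forall u, A u -> f u = h u) ->
  differentiable_upto k A f -> differentiable_upto k A h.
Proof.
move=> oA; elim: k f h => [|k IH] f h fh.
  move=> /differentiable_upto0 Af; apply/differentiable_upto0 => u Au.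
  apply: near_eq_differentiable (Af u Au).
  by near=> z; apply: fh; near: z; exact: open_nbhs_nbhs.
move=> /differentiable_uptoS[Af dAf]; apply/differentiable_uptoS; split.
  move=> u Au; apply: near_eq_differentiable (Af u Au).
  by near=> z; apply: fh; near: z; exact: open_nbhs_nbhs.
move=> i; apply: IH (dAf i) => u Au; apply: near_eq_derive.
by near=> z; apply: fh; near: z; exact: open_nbhs_nbhs.
Unshelve. all: by end_near. Qed.

Lemma differentiable_upto_cst k A (a : R) : open A ->
  differentiable_upto k A (cst a).
Proof.
move=> oA; elim: k a => [|k IH] a.
  by apply/differentiable_upto0 => u _; exact: differentiable_cst.
apply/differentiable_uptoS; split=> [u _|i]; first exact: differentiable_cst.
by apply: differentiable_upto_eq (IH 0) => // u _; rewrite /partial_derivative derive_cst.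
Qed.

Lemma differentiable_uptoD k A f h : open A ->
  differentiable_upto k A f -> differentiable_upto k A h ->
  differentiable_upto k A (f \+ h).
Proof.
move=> oA; elim: k f h => [|k IH] f h.
  move=> /differentiable_upto0 Af /differentiable_upto0 Ah.
  apply/differentiable_upto0 => u Au.
  exact: (differentiableD (Af u Au) (Ah u Au)).
move=> /differentiable_uptoS[Af dAf] /differentiable_uptoS[Ah dAh].
apply/differentiable_uptoS; split=> [u Au|i].
  exact: (differentiableD (Af u Au) (Ah u Au)).
apply: differentiable_upto_eq (IH _ _ (dAf i) (dAh i)) => // u Au.
by apply/esym/deriveD; apply: diff_derivable; [exact: Af|exact: Ah].
Qed.

Lemma differentiable_uptoM k A f h : open A ->
  differentiable_upto k A f -> differentiable_upto k A h ->
  differentiable_upto k A (f \* h).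
Proof.
move=> oA; elim: k f h => [|k IH] f h.
  move=> /differentiable_upto0 Af /differentiable_upto0 Ah.
  apply/differentiable_upto0 => u Au.
  exact: (differentiableM (Af u Au) (Ah u Au)).
move=> Afk Ahk; have Af' := differentiable_uptoW Afk.
have Ah' := differentiable_uptoW Ahk.
case/differentiable_uptoS: Afk => Af dAf.
case/differentiable_uptoS: Ahk => Ah dAh.
apply/differentiable_uptoS; split=> [u Au|i].
  exact: (differentiableM (Af u Au) (Ah u Au)).
apply: differentiable_upto_eq
  (differentiable_uptoD oA (IH _ _ Af' (dAh i)) (IH _ _ Ah' (dAf i))) => // u Au.
by apply/esym/deriveM; apply: diff_derivable; [exact: Af|exact: Ah].
Qed.

Lemma differentiable_expR (f : 'rV[R]_n -> R) u :
  differentiable f u -> differentiable (expR \o f) u.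
Proof.
move=> df; apply: differentiable_comp => //.
exact/derivable1_diffP/derivable_expR.
Qed.

Lemma derive_expR_comp (f : 'rV[R]_n -> R) u v :
  differentiable f u -> 'D_v (expR \o f) u = expR (f u) * 'D_v f u.
Proof.
move=> df; have de : differentiable (@expR R) (f u).
  exact/derivable1_diffP/derivable_expR.
rewrite deriveE; last exact: differentiable_expR.
rewrite diff_comp//= diff1E// derive1E (deriveE v df) [RHS]mulrC.
congr (_ *: _); exact: (congr1 (@^~ (f u)) (derive_expR R)).
Qed.

Lemma differentiable_upto_expR k A f : open A ->
  differentiable_upto k A f -> differentiable_upto k A (expR \o f).
Proof.
move=> oA; elim: k => [|k IH].
  move=> /differentiable_upto0 Af; apply/differentiable_upto0 => u Au.
  exact: differentiable_expR (Af u Au).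
move=> Afk; have Af' := differentiable_uptoW Afk.
case/differentiable_uptoS: Afk => Af dAf.
apply/differentiable_uptoS; split=> [u Au|i].
  exact: differentiable_expR (Af u Au).
apply: differentiable_upto_eq
  (differentiable_uptoM oA (IH Af') (dAf i)) => // u Au.
by rewrite /partial_derivative derive_expR_comp//; exact: Af.
Qed.

Lemma euclidean_smoothW A B f : B `<=` A ->
  euclidean_smooth A f -> euclidean_smooth B f.
Proof. by move=> BA Af s u /BA; exact: Af. Qed.

End EuclideanCalculus.

(** * Tangent vectors and vector fields *)

Section ManifoldCalculus.
Context {R : realType} {n : nat} {M : smooth_manifold R n}.
Implicit Types (x y : M) (U V : set M) (f h : M -> R) (v u : vec M)
  (X Y Z : vfield M).

(** The image is the preimage of [V] under the continuous inverse chart, cut down to the open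
    codomain. *)
Lemma chart_image_open (c : chart R n M) V : open V ->
  open (chart_map c @` (V `&` chart_dom c)).
Proof.
move=> oV; have oC := @chart_codom_open _ _ _ c.
have inv_cont := @chart_inv_continuous _ _ _ c.
rewrite (_ : _ @` _ = (chart_map c @` chart_dom c) `&` chart_inv c @^-1` V).
  rewrite continuous_open_subspace// in inv_cont.
  rewrite openE => u [Cu Vu].
  apply: (filterI (open_nbhs_nbhs (conj oC Cu))).
  apply: inv_cont; first by rewrite inE.
  exact: open_nbhs_nbhs.
apply/seteqP; split=> [_ [y [Vy cy] <-]|_ [[y cy <-]]].
  by split; [exists y|rewrite /= chart_mapK ?inE].
by rewrite /= chart_mapK ?inE// => Vy; exists y.
Qed.

Lemma smooth_onW U V f : V `<=` U -> smooth_on U f -> smooth_on V f.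
Proof.
move=> VU Uf c ac; apply: euclidean_smoothW (Uf c ac).
by apply: image_subset => y [/VU].
Qed.

Lemma smooth_on_eq U f h : open U -> (forall y, U y -> f y = h y) ->
  smooth_on U f -> smooth_on U h.
Proof.
move=> oU fh Uf c ac; apply/euclidean_smoothE => k.
have /euclidean_smoothE/(_ k) := Uf c ac.
apply: differentiable_upto_eq; first exact: chart_image_open.
by move=> _ [y [Uy cy] <-]; rewrite /= chart_mapK ?inE// fh.
Qed.

Lemma smooth_on_cst U (a : R) : open U -> smooth_on U (fun _ => a).
Proof.
move=> oU c ac; apply/euclidean_smoothE => k.
exact/differentiable_upto_cst/chart_image_open.
Qed.

Lemma smooth_onD U f h : open U -> smooth_on U f -> smooth_on U h ->
  smooth_on U (fun y => f y + h y).
Proof.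
move=> oU Uf Uh c ac; apply/euclidean_smoothE => k.
have /euclidean_smoothE/(_ k) := Uf c ac.
have /euclidean_smoothE/(_ k) := Uh c ac.
by move=> /[swap]; apply: differentiable_uptoD; exact: chart_image_open.
Qed.

Lemma smooth_onM U f h : open U -> smooth_on U f -> smooth_on U h ->
  smooth_on U (fun y => f y * h y).
Proof.
move=> oU Uf Uh c ac; apply/euclidean_smoothE => k.
have /euclidean_smoothE/(_ k) := Uf c ac.
have /euclidean_smoothE/(_ k) := Uh c ac.
by move=> /[swap]; apply: differentiable_uptoM; exact: chart_image_open.
Qed.

Lemma smooth_onZ U (a : R) f : open U -> smooth_on U f ->
  smooth_on U (fun y => a * f y).
Proof. by move=> oU; apply: smooth_onM => //; exact: smooth_on_cst. Qed.

Lemma smooth_on_expR U f : open U -> smooth_on U f ->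
  smooth_on U (fun y => expR (f y)).
Proof.
move=> oU Uf c ac; apply/euclidean_smoothE => k.
have /euclidean_smoothE/(_ k) := Uf c ac.
by apply: differentiable_upto_expR; exact: chart_image_open.
Qed.

Lemma smooth_on_at U x f : open_nbhs x U -> smooth_on U f -> smooth_at x f.
Proof. by move=> xU Uf; exists U. Qed.

Lemma smooth_at_eq U x f h : open_nbhs x U -> (forall y, U y -> f y = h y) ->
  smooth_at x f -> smooth_at x h.
Proof.
move=> xU fh [V xV Vf]; exists (U `&` V); first exact: open_nbhsI.
have [oUV _] := open_nbhsI xU xV.
apply: (smooth_on_eq (f := f)) => // [y [Uy _]|]; first exact: fh.
by apply: smooth_onW Vf => y [].
Qed.

Lemma smooth_at_differentiable x f (c : chart R n M) :
  atlas c -> chart_dom c x -> smooth_at x f ->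
  differentiable (f \o chart_inv c) (chart_map c x).
Proof. by move=> ac cx [U [oU Ux] Uf]; apply: (Uf c ac [::]); exists x. Qed.

Lemma transition_differentiable x (c d : chart R n M) :
  atlas c -> atlas d -> chart_dom c x -> chart_dom d x ->
  differentiable (chart_map d \o chart_inv c) (chart_map c x).
Proof.
move=> ac ad cx dx.
rewrite (_ : _ \o _ = \sum_(i < n) (fun z => chart_map d (chart_inv c z) 0 i *:
  (delta_mx 0 i : 'rV[R]_n))); last first.
  apply/funext => z /=.
  rewrite [LHS]row_sum_delta fct_sumE; exact: eq_bigr.
apply: differentiable_sum => i; apply: differentiableZl.
by apply: (@atlas_smooth _ _ M c d ac ad i [::]); exists x.
Qed.

(** A tangent vector comes with some chart of its own; the differential of the transition map
    carries its coordinates to any other chart. Two vectors can then be added in a common one. *)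
Lemma tangent_chart x v (d : chart R n M) :
  atlas d -> chart_dom d x -> tangent x v ->
  exists w : 'rV[R]_n, v = fun f =>
    if `[< smooth_at x f >] then 'D_w (f \o chart_inv d) (chart_map d x) else 0.
Proof.
move=> ad dx [c [ac cx [w ->]]].
exists ('D_w (chart_map d \o chart_inv c) (chart_map c x)).
apply/funext => f; case: asboolP => // xf.
have dt := transition_differentiable ac ad cx dx.
have tx : (chart_map d \o chart_inv c) (chart_map c x) = chart_map d x.
  by rewrite /= chart_mapK ?inE.
have df := smooth_at_differentiable ad dx xf.
rewrite (@near_eq_derive _ _ _ _
  ((f \o chart_inv d) \o (chart_map d \o chart_inv c))); last first.
  have oA : open (chart_map c @` (chart_dom d `&` chart_dom c)).
    exact/chart_image_open/chart_dom_open.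
  have Ax : (chart_map c @` (chart_dom d `&` chart_dom c)) (chart_map c x).
    by exists x.
  near=> z.
  have [y [dy cy] <-] : (chart_map c @` (chart_dom d `&` chart_dom c)) z.
    by near: z; exact: open_nbhs_nbhs.
  by rewrite /= !chart_mapK ?inE.
rewrite deriveE; last by apply: differentiable_comp; rewrite ?tx.
by rewrite diff_comp ?tx//= -!deriveE ?tx.
Unshelve. all: by end_near. Qed.

Lemma vec_addE u v f : (u + v) f = u f + v f.
Proof. by []. Qed.

Lemma vec_scaleE (a : R) v f : (a *: v) f = a * v f.
Proof. by []. Qed.

Lemma vec_oppE v f : (- v) f = - v f.
Proof. by []. Qed.

Lemma tangentD x u v : tangent x u -> tangent x v -> tangent x (u + v).
Proof.
move=> tu tv; have [c ac cx] := atlas_cover x.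
have [w ->] := tangent_chart ac cx tu; have [w' ->] := tangent_chart ac cx tv.
exists c; split=> //; exists (w + w'); apply/funext => f.
rewrite vec_addE; case: asboolP => [xf|_]; last by rewrite addr0.
have df := smooth_at_differentiable ac cx xf.
by rewrite !deriveE// linearD.
Qed.

Lemma tangentZ x (a : R) v : tangent x v -> tangent x (a *: v).
Proof.
move=> [c [ac cx [w ->]]]; exists c; split=> //; exists (a *: w).
apply/funext => f; rewrite vec_scaleE; case: asboolP => [xf|_].
  have df := smooth_at_differentiable ac cx xf.
  by rewrite !deriveE// linearZ.
by rewrite mulr0.
Qed.

Lemma tangent0 x : tangent x (0 : vec M).
Proof.
have [c ac cx] := atlas_cover x; exists c; split=> //; exists 0.
by apply/funext => f; rewrite derive0 if_same.
Qed.

Lemma tangent_sum x (I : Type) (r : seq I) (P : pred I) (F : I -> vec M) :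
  (forall i, P i -> tangent x (F i)) -> tangent x (\sum_(i <- r | P i) F i).
Proof.
by move=> tF; elim/big_rec: _ => [|i u Pi tu]; [exact: tangent0|
  exact: tangentD (tF i Pi) tu].
Qed.

Lemma tangentB x u v : tangent x u -> tangent x v -> tangent x (u - v).
Proof. by move=> tu tv; rewrite -scaleN1r; apply/tangentD/tangentZ. Qed.

Lemma tangentN x v : tangent x v -> tangent x (- v).
Proof. by move=> tv; rewrite -scaleN1r; exact: tangentZ. Qed.

(** The default value 0 reduces an equality of tangent vectors to functions smooth near the
    point. *)
Lemma tangent_nonsmooth x v f : tangent x v -> ~ smooth_at x f -> v f = 0.
Proof. by move=> [c [_ _ [w ->]]] nf; case: asboolP. Qed.

(** Both the smoothness test at [x] and the derivative behind it depend on the germ alone. *)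
Lemma tangent_local U x v f h : open_nbhs x U ->
  (forall y, U y -> f y = h y) -> tangent x v -> v f = v h.
Proof.
move=> xU fh [c [ac cx [w ->]]].
have fhS : smooth_at x f <-> smooth_at x h.
  by split; apply: (smooth_at_eq xU) => y Uy; rewrite fh.
rewrite (propext fhS); case: asboolP => // _.
apply: near_eq_derive.
have oA : open (chart_map c @` (U `&` chart_dom c)).
  exact/chart_image_open/xU.1.
have Ax : (chart_map c @` (U `&` chart_dom c)) (chart_map c x).
  by exists x => //; split=> //; exact: xU.2.
near=> z.
have [y [Uy cy] <-] : (chart_map c @` (U `&` chart_dom c)) z.
  by near: z; exact: open_nbhs_nbhs.
by rewrite /= chart_mapK ?inE// fh.
Unshelve. all: by end_near. Qed.

Lemma tangent_derivation U x v f h : open_nbhs x U -> tangent x v ->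
  smooth_on U f -> smooth_on U h ->
  v (fun y => f y * h y) = f x * v h + h x * v f.
Proof.
move=> xU [c [ac cx [w ->]]] Uf Uh.
have xf := smooth_on_at xU Uf; have xh := smooth_on_at xU Uh.
rewrite !asboolT//; last by apply: (smooth_on_at xU); apply: smooth_onM xU.1 _ _.
have df := smooth_at_differentiable ac cx xf.
have dh := smooth_at_differentiable ac cx xh.
have := deriveM (diff_derivable (v := w) df) (diff_derivable (v := w) dh).
by rewrite /= chart_mapK ?inE.
Qed.

Lemma tangent_cst x v (a : R) : tangent x v -> v (fun _ => a) = 0.
Proof.
by move=> [c [ac cx [w ->]]]; rewrite [_ \o _](_ : _ = cst a)// derive_cst if_same.
Qed.

Lemma tangent_scale U x v (a : R) f : open_nbhs x U -> tangent x v ->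
  smooth_on U f -> v (fun y => a * f y) = a * v f.
Proof.
move=> xU tv Uf; rewrite (tangent_derivation xU tv (smooth_on_cst a xU.1) Uf).
by rewrite (tangent_cst a tv) mulr0 addr0.
Qed.

Lemma tangent_expR U x v f : open_nbhs x U -> tangent x v -> smooth_on U f ->
  v (fun y => expR (f y)) = expR (f x) * v f.
Proof.
move=> xU [c [ac cx [w ->]]] Uf.
have xf := smooth_on_at xU Uf.
rewrite !asboolT//; last first.
  by apply: (smooth_on_at xU); apply: smooth_on_expR xU.1 _.
have := derive_expR_comp w (smooth_at_differentiable ac cx xf).
by rewrite /= chart_mapK ?inE.
Qed.

Lemma vector_fieldW U V X : V `<=` U -> vector_field U X -> vector_field V X.
Proof.
move=> VU [tX sX]; split=> [y /VU|W f oW WV]; first exact: tX.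
by apply: sX => //; exact: subset_trans VU.
Qed.

Lemma vector_field_eq U X Y : (forall y, U y -> X y = Y y) ->
  vector_field U X -> vector_field U Y.
Proof.
move=> XY [tX sX]; split=> [y Uy|V f oV VU Vf]; first by rewrite -XY//; exact: tX.
by apply: smooth_on_eq (sX V f oV VU Vf) => // y /VU Uy; rewrite XY.
Qed.

Lemma vector_fieldD U X Y : vector_field U X -> vector_field U Y ->
  vector_field U (fun y => X y + Y y).
Proof.
move=> [tX sX] [tY sY]; split=> [y Uy|V f oV VU Vf].
  by apply: tangentD; [exact: tX|exact: tY].
by apply: smooth_onD => //; [exact: sX|exact: sY].
Qed.

Lemma vector_fieldZ U f X : open U -> smooth_on U f -> vector_field U X ->
  vector_field U (fun y => f y *: X y).
Proof.
move=> oU Uf [tX sX]; split=> [y Uy|V h oV VU Vh].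
  by apply: tangentZ; exact: tX.
by apply: smooth_onM => //; [exact: smooth_onW Uf|exact: sX].
Qed.

Lemma vector_field0 U : vector_field U (fun _ => 0).
Proof. by split=> [y _|V f oV _ _]; [exact: tangent0|exact: smooth_on_cst]. Qed.

Lemma vector_fieldN U X : open U -> vector_field U X ->
  vector_field U (fun y => - X y).
Proof.
move=> oU /(vector_fieldZ oU (smooth_on_cst (-1) oU)).
by apply: vector_field_eq => y _; rewrite scaleN1r.
Qed.

Lemma vector_field_sum U (I : Type) (r : seq I) (F : I -> vfield M) :
  (forall i, vector_field U (F i)) -> vector_field U (fun y => \sum_(i <- r) F i y).
Proof.
move=> UF; elim: r => [|i r IH].
  by apply: vector_field_eq (vector_field0 U) => y _; rewrite big_nil.
apply: vector_field_eq (vector_fieldD (UF i) IH) => y _; by rewrite big_cons.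
Qed.

End ManifoldCalculus.

(** * Metrics, connections and the conformal change *)

(* Hypotheses are matched syntactically: unifying distinct tangent vectors up
   to conversion is very slow. *)
Ltac solve_tangent :=
  repeat first
    [ match goal with H : tangent ?x ?v |- tangent ?x ?v => exact H end
    | match goal with
      H : forall i, tangent ?x (@?v i) |- tangent ?x _ => simple apply H end
    | lazymatch goal with
      | |- tangent _ (_ + _) => apply: tangentD
      | |- tangent _ (- _) => apply: tangentN
      | |- tangent _ (_ *: _) => apply: tangentZ
      | |- tangent _ 0 => apply: tangent0
      | |- tangent _ (bigop _ _ _) => apply: tangent_sum => *
      end ].

#[local] Hint Extern 0 (tangent _ _) => solve [solve_tangent] : core.

Section MetricAlgebra.
Context {R : realType} {n : nat} {M : smooth_manifold R n} {g : tensor2 M}.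
Hypothesis hg : riemannian_metric g.
Implicit Types (x y : M) (u v w : vec M).

Lemma metricC x u v : tangent x u -> tangent x v -> g x u v = g x v u.
Proof. exact: Defs.metric_sym. Qed.

Lemma metricDl x u v w : tangent x u -> tangent x v -> tangent x w ->
  g x (u + v) w = g x u w + g x v w.
Proof.
by move=> tu tv tw; rewrite -[u]scale1r (metric_linear hg)// mul1r scale1r.
Qed.

Lemma metric0l x w : tangent x w -> g x 0 w = 0.
Proof.
move=> tw; have /eqP := metricDl (tangent0 x) (tangent0 x) tw.
by rewrite addr0 -subr_eq0 opprD addNKr oppr_eq0 => /eqP.
Qed.

Lemma metricZl x (a : R) u w : tangent x u -> tangent x w ->
  g x (a *: u) w = a * g x u w.
Proof.
move=> tu tw; rewrite -[a *: u]addr0 (metric_linear hg)//.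
by rewrite metric0l// addr0.
Qed.

Lemma metricNl x u w : tangent x u -> tangent x w -> g x (- u) w = - g x u w.
Proof. by move=> tu tw; rewrite -scaleN1r metricZl// mulN1r. Qed.

Lemma metricBl x u v w : tangent x u -> tangent x v -> tangent x w ->
  g x (u - v) w = g x u w - g x v w.
Proof.
move=> tu tv tw; rewrite -[- v]scaleN1r metricDl// metricZl// mulN1r.
by [].
Qed.

Lemma metric_suml x (I : Type) (r : seq I) (F : I -> vec M) w :
  (forall i, tangent x (F i)) -> tangent x w ->
  g x (\sum_(i <- r) F i) w = \sum_(i <- r) g x (F i) w.
Proof.
move=> tF tw; elim: r => [|i r IH]; first by rewrite !big_nil metric0l.
by rewrite !big_cons metricDl// IH.
Qed.

Lemma metricDr x u v w : tangent x u -> tangent x v -> tangent x w ->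
  g x w (u + v) = g x w u + g x w v.
Proof. by move=> *; rewrite !(metricC (u := w))// metricDl. Qed.

Lemma metricZr x (a : R) u w : tangent x u -> tangent x w ->
  g x w (a *: u) = a * g x w u.
Proof. by move=> *; rewrite !(metricC (u := w))// metricZl. Qed.

Lemma metricBr x u v w : tangent x u -> tangent x v -> tangent x w ->
  g x w (u - v) = g x w u - g x w v.
Proof. by move=> *; rewrite !(metricC (u := w))// metricBl. Qed.

Lemma metricNr x u w : tangent x u -> tangent x w -> g x w (- u) = - g x w u.
Proof. by move=> *; rewrite !(metricC (u := w))// metricNl. Qed.

Lemma metric_sumr x (I : Type) (r : seq I) (F : I -> vec M) w :
  (forall i, tangent x (F i)) -> tangent x w ->
  g x w (\sum_(i <- r) F i) = \sum_(i <- r) g x w (F i).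
Proof.
move=> tF tw; rewrite metricC// metric_suml//.
by apply: eq_bigr => i _; rewrite metricC.
Qed.

(** Testing against [u - v] itself contradicts positivity unless it vanishes. *)
Lemma metric_inj x u v : tangent x u -> tangent x v ->
  (forall w, tangent x w -> g x u w = g x v w) -> u = v.
Proof.
move=> tu tv uv; apply/eqP; rewrite -subr_eq0; apply/negPn/negP => d0.
have := metric_pos hg (tangentB tu tv) d0.
by rewrite metricBl// uv// subrr ltxx.
Qed.

Lemma orthonormal_decomp (S : M -> set (vec M)) (U : set M) k
    (e : 'I_k -> vfield M) x v :
  orthonormal_frame g S U e -> U x -> S x v ->
  v = \sum_(i < k) g x v (e i x) *: e i x.
Proof.
move=> [eS /(_ _)ePe] Ux Sv; have [eON /(_ _ Sv)[c ->]] := ePe _ Ux.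
have te i : tangent x (e i x) by have [[+ _] _] := eS i; apply.
apply: eq_bigr => i _; congr (_ *: _).
rewrite metric_suml// (bigD1 i)//= metricZl// eON eqxx mulr1 big1 ?addr0//.
by move=> j /negPf ji; rewrite metricZl// eON ji mulr0.
Qed.

End MetricAlgebra.

(* Connections act on fields, so pointwise statements about them need every
   tangent vector to extend to a field. *)
Definition extendable {R : realType} {n : nat} {M : smooth_manifold R n}
    (U : set M) := forall (x : M) (v : vec M), U x -> tangent x v ->
  exists2 X : vfield M, vector_field U X & X x = v.

(** Constant coefficients in the frame extend [v] to all of [U], so no cutoff function enters. *)
Lemma frame_extendable (R : realType) (n : nat) (M : smooth_manifold R n)
    (g : tensor2 M) (hg : riemannian_metric g) (U : set M) (k : nat)
    (E : 'I_k -> vfield M) :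
  open U -> orthonormal_frame g (@tangent R n M) U E -> extendable U.
Proof.
move=> oU hE x v Ux tv.
exists (fun y => \sum_(i < k) g x v (E i x) *: E i y).
  apply: vector_field_sum => i; apply: (vector_fieldZ (f := fun=> g x v (E i x))).
  - exact: oU.
  - exact: smooth_on_cst.
  - by have [/(_ i)[]] := hE.
exact/esym/(orthonormal_decomp hg hE Ux tv).
Qed.

(** * Calculus of a connection over an open set *)

Section Connection.
Context {R : realType} {n : nat} {M : smooth_manifold R n} {h : tensor2 M}.
Context {D : connection M} {U : set M}.
Hypotheses (hD : levi_civita h D) (oU : open U) (extU : extendable U).
Implicit Types (x y : M) (u v w : vec M) (X Y Z : vfield M).

(** Locality from the Leibniz rule. The difference [W] vanishes on [U], and [f] is 0 on [U] and 1
    outside, so [f W = W] as total functions; expanding the derivative of [f W] at [x] gives 0 since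
    [f x = 0] and [W x = 0]. *)
Lemma connection_eq x v Y Z : U x -> tangent x v ->
  vector_field U Y -> vector_field U Z -> (forall y, U y -> Y y = Z y) ->
  D x v Y = D x v Z.
Proof.
move=> Ux tv UY UZ YZ.
pose W y := Y y - Z y; pose f y : R := if `[< U y >] then 0 else 1.
have UW : vector_field U W by apply: vector_fieldD => //; exact: vector_fieldN.
have Uf : smooth_on U f.
  apply: smooth_on_eq (smooth_on_cst 0 oU) => // y Uy.
  by rewrite /f asboolT.
have fW : (fun y => f y *: W y) = W.
  apply/funext => y; rewrite /f /W; case: asboolP => Uy; last by rewrite scale1r.
  by rewrite YZ// subrr scaler0.
have W0 : D x v W = 0.
  rewrite -fW (lc_leibniz hD oU Ux Uf UW tv) /W YZ// subrr scaler0 add0r.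
  by rewrite /f asboolT// scale0r.
have -> : Y = fun y => Z y + W y by apply/funext => y; rewrite addrC subrK.
by rewrite (lc_additive hD oU Ux UZ UW tv) W0 addr0.
Qed.

(** [lc_smooth] speaks of directions given by fields, so [v] is first extended. *)
Lemma connection_tangent x v Y : U x -> tangent x v -> vector_field U Y ->
  tangent x (D x v Y).
Proof.
move=> Ux tv UY; have [V UV <-] := extU Ux tv.
by have [+ _] := lc_smooth hD oU UV UY; exact.
Qed.

Lemma connectionDl x u v Y : U x -> vector_field U Y ->
  tangent x u -> tangent x v -> D x (u + v) Y = D x u Y + D x v Y.
Proof.
move=> Ux UY tu tv.
by rewrite -{1}[u]scale1r (lc_linear hD 1 oU Ux UY tu tv) scale1r.
Qed.

Lemma connection0l x Y : U x -> vector_field U Y -> D x 0 Y = 0.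
Proof.
move=> Ux UY; have /eqP := connectionDl Ux UY (tangent0 x) (tangent0 x).
by rewrite addr0 -subr_eq0 opprD addNKr oppr_eq0 => /eqP.
Qed.

Lemma connectionZl x (a : R) v Y : U x -> vector_field U Y ->
  tangent x v -> D x (a *: v) Y = a *: D x v Y.
Proof.
move=> Ux UY tv; rewrite -[a *: v]addr0 (lc_linear hD a oU Ux UY tv (tangent0 x)).
by rewrite connection0l// addr0.
Qed.

Lemma connection_suml x (I : Type) (r : seq I) (F : I -> vec M) Y :
  U x -> vector_field U Y -> (forall i, tangent x (F i)) ->
  D x (\sum_(i <- r) F i) Y = \sum_(i <- r) D x (F i) Y.
Proof.
move=> Ux UY tF; elim: r => [|i r IH]; first by rewrite !big_nil connection0l.
by rewrite !big_cons connectionDl// IH.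
Qed.

Lemma connectionZr x v (a : R) Y : U x -> tangent x v -> vector_field U Y ->
  D x v (fun y => a *: Y y) = a *: D x v Y.
Proof.
move=> Ux tv UY.
rewrite (lc_leibniz hD oU Ux (smooth_on_cst a oU) UY tv).
by rewrite (tangent_cst a tv) scale0r add0r.
Qed.

Lemma connection0r x v : U x -> tangent x v -> D x v (fun _ => 0) = 0.
Proof.
move=> Ux tv; rewrite -[RHS](scale0r (D x v (fun=> 0))).
rewrite -(connectionZr 0 Ux tv (vector_field0 U)); congr (D x v _).
by apply/funext => y; rewrite scaler0.
Qed.

Lemma connectionBr x v Y Z : U x -> tangent x v ->
  vector_field U Y -> vector_field U Z ->
  D x v (fun y => Y y - Z y) = D x v Y - D x v Z.
Proof.
move=> Ux tv UY UZ; rewrite (lc_additive hD oU Ux UY (vector_fieldN oU UZ) tv).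
congr (_ + _); rewrite -scaleN1r -connectionZr//; congr (D x v _).
by apply/funext => y; rewrite scaleN1r.
Qed.

Lemma connection_sumr x v (I : Type) (r : seq I) (F : I -> vfield M) :
  U x -> tangent x v -> (forall i, vector_field U (F i)) ->
  D x v (fun y => \sum_(i <- r) F i y) = \sum_(i <- r) D x v (F i).
Proof.
move=> Ux tv UF; elim: r => [|i r IH].
  rewrite big_nil -[RHS](connection0r Ux tv); congr (D x v _).
  by apply/funext => y; rewrite big_nil.
rewrite big_cons -IH -(lc_additive hD oU Ux (UF i) (vector_field_sum r UF) tv).
by congr (D x v _); apply/funext => y; rewrite big_cons.
Qed.

Lemma connection_linl x (I : Type) (r : seq I) (c : I -> R) (F : I -> vec M) Y :
  U x -> vector_field U Y -> (forall i, tangent x (F i)) ->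
  D x (\sum_(i <- r) c i *: F i) Y = \sum_(i <- r) c i *: D x (F i) Y.
Proof.
move=> Ux UY tF; rewrite connection_suml//.
by apply: eq_bigr => i _; rewrite connectionZl.
Qed.

(** The field has the shape of a conformally changed derivative: [nabla_A X] plus two multiples of
    fields minus a multiple of the gradient. The second derivative in the tension field needs it
    differentiated once more. *)
Lemma connection_comb x v (f f' f'' : M -> R) Y Z Z' Z'' :
  U x -> tangent x v ->
  smooth_on U f -> smooth_on U f' -> smooth_on U f'' ->
  vector_field U Y -> vector_field U Z -> vector_field U Z' ->
  vector_field U Z'' ->
  D x v (fun y => Y y + (f y *: Z y + f' y *: Z' y - f'' y *: Z'' y)) =
  D x v Y + (v f *: Z x + f x *: D x v Z + (v f' *: Z' x + f' x *: D x v Z')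
    - (v f'' *: Z'' x + f'' x *: D x v Z'')).
Proof.
move=> Ux tv Uf Uf' Uf'' UY UZ UZ' UZ''.
have U1 := vector_fieldZ oU Uf UZ; have U2 := vector_fieldZ oU Uf' UZ'.
have U3 := vector_fieldZ oU Uf'' UZ''; have U12 := vector_fieldD U1 U2.
have UB := vector_fieldD U12 (vector_fieldN oU U3).
rewrite (lc_additive hD oU Ux UY UB tv) (connectionBr Ux tv U12 U3).
rewrite (lc_additive hD oU Ux U1 U2 tv) (lc_leibniz hD oU Ux Uf UZ tv).
by rewrite (lc_leibniz hD oU Ux Uf' UZ' tv) (lc_leibniz hD oU Ux Uf'' UZ'' tv).
Qed.

End Connection.

(** * The gradient as a smooth field *)

Section Gradient.
Context {R : realType} {n k : nat} {M : smooth_manifold R n} {g : tensor2 M}.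
Context {U : set M} {E : 'I_k -> vfield M} {mu : M -> R}.
Hypotheses (hg : riemannian_metric g) (oU : open U).
Hypothesis hE : orthonormal_frame g (@tangent R n M) U E.

Lemma frame_tangent i y : U y -> tangent y (E i y).
Proof. by move=> Uy; have [/(_ i)[[+ _] _] _] := hE; exact. Qed.

(** Witness for the choice in [gradient], which otherwise could fall back on its default 0. *)
Lemma gradient_frameP y : U y ->
  (fun w : vec M => tangent y w /\ forall v, tangent y v -> g y w v = v mu)
  (\sum_(i < k) (E i y mu) *: E i y).
Proof.
move=> Uy; have tE i := frame_tangent i Uy; split=> [|v tv]; first by [].
rewrite metric_suml// [in RHS](orthonormal_decomp hg hE Uy tv) fct_sumE.
by apply: eq_bigr => i _; rewrite vec_scaleE metricZl// mulrC (metricC hg).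
Qed.

Lemma gradientP y : U y -> tangent y (gradient g mu y) /\
  forall v, tangent y v -> g y (gradient g mu y) v = v mu.
Proof. by move=> Uy; exact: (xgetI _ (gradient_frameP Uy)). Qed.

Lemma gradient_tangent y : U y -> tangent y (gradient g mu y).
Proof. by case/gradientP. Qed.

Lemma gradientE y v : U y -> tangent y v -> g y (gradient g mu y) v = v mu.
Proof. by case/gradientP => _; apply. Qed.

(** A pointwise choice carries no smoothness; uniqueness identifies it with the frame formula, which
    is smooth. *)
Lemma gradient_field : smooth_on U mu -> vector_field U (gradient g mu).
Proof.
move=> Umu.
apply: (vector_field_eq (X := fun y => \sum_(i < k) (E i y mu) *: E i y)).
  move=> y Uy; have [t1 e1] := gradient_frameP Uy.
  have [t2 e2] := gradientP Uy.
  by apply: (metric_inj hg t1 t2) => w tw; rewrite e1// e2.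
apply: vector_field_sum => i; have [/(_ i)[[tE sE] _] _] := hE.
by apply: vector_fieldZ => //; exact: sE.
Qed.

End Gradient.

(** * The difference of the two Levi-Civita connections *)

Section ConformalConnection.
Context {R : realType} {n k : nat} {M : smooth_manifold R n} {g : tensor2 M}.
Context {U : set M} {E : 'I_k -> vfield M} {mu : M -> R}.
Context {nabla nablat : connection M}.
Hypotheses (hg : riemannian_metric g) (oU : open U).
Hypothesis hE : orthonormal_frame g (@tangent R n M) U E.
Hypothesis hmu : smooth_on setT mu.
Hypothesis hnabla : levi_civita g nabla.
Hypothesis hnablat : levi_civita (conformal_metric mu g) nablat.
Implicit Types (A B C : vfield M).

Let extU : extendable U := frame_extendable hg oU hE.

(** Both connections are torsion free, so their antisymmetrisations in [A] and [B] are the same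
    bracket. *)
Lemma connection_difference_sym A B y : U y ->
  vector_field U A -> vector_field U B ->
  nablat y (A y) B - nabla y (A y) B = nablat y (B y) A - nabla y (B y) A.
Proof.
move=> Uy UA UB.
have tA : tangent y (A y) by case: UA => + _; exact.
have tB : tangent y (B y) by case: UB => + _; exact.
suff H : nablat y (A y) B - nablat y (B y) A =
    nabla y (A y) B - nabla y (B y) A.
  rewrite -[nablat y (A y) B](subrK (nablat y (B y) A)) H.
  by rewrite addrAC [X in X + _]addrAC subrr sub0r addrC.
have t1 := connection_tangent hnablat oU extU Uy tA UB.
have t2 := connection_tangent hnablat oU extU Uy tB UA.
have t3 := connection_tangent hnabla oU extU Uy tA UB.
have t4 := connection_tangent hnabla oU extU Uy tB UA.
apply/funext => f; have [yf|yf] := pselect (smooth_at y f); last first.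
  by rewrite !(@tangent_nonsmooth _ _ _ y _ f).
(* [lc_torsion_free] wants the fields and the test function smooth on one open set, hence the
   restriction to the intersection of [U] and [V]. *)
have [V [oV Vy] Vf] := yf.
have oUV : open (U `&` V) by exact: openI.
have UVU : U `&` V `<=` U by move=> ? [].
have UVV : U `&` V `<=` V by move=> ? [].
have UVf := smooth_onW UVV Vf.
rewrite (lc_torsion_free hnabla oUV _ (vector_fieldW UVU UA) (vector_fieldW UVU UB))//.
by rewrite (lc_torsion_free hnablat oUV _ (vector_fieldW UVU UA) (vector_fieldW UVU UB)).
Qed.

(** The derivative of [exp(2 mu) g(B, C)] along [A] is computed twice, by compatibility of [nablat]
    and by the product rule with compatibility of [nabla]; the exponential is then cancelled. *)
Lemma connection_difference_metric A B C y : U y ->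
  vector_field U A -> vector_field U B -> vector_field U C ->
  g y (nablat y (A y) B - nabla y (A y) B) (C y) +
  g y (B y) (nablat y (A y) C - nabla y (A y) C) =
  2 * A y mu * g y (B y) (C y).
Proof.
move=> Uy UA UB UC.
have tA : tangent y (A y) by case: UA => + _; exact.
have tB : tangent y (B y) by case: UB => + _; exact.
have tC : tangent y (C y) by case: UC => + _; exact.
have yU : open_nbhs y U by [].
have t1 := connection_tangent hnablat oU extU Uy tA UB.
have t2 := connection_tangent hnablat oU extU Uy tA UC.
have t3 := connection_tangent hnabla oU extU Uy tA UB.
have t4 := connection_tangent hnabla oU extU Uy tA UC.
have Umu : smooth_on U mu by exact: smooth_onW hmu.
have U2mu := smooth_onZ 2 oU Umu.
have e1 := lc_metric hnabla oU Uy UB UC tA.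
have e2 := lc_metric hnablat oU Uy UB UC tA.
have := tangent_derivation yU tA (smooth_on_expR oU U2mu) (metric_smooth hg oU UB UC).
rewrite e1 (tangent_expR yU tA U2mu) (tangent_scale 2 yU tA Umu).
move: e2; rewrite /conformal_metric => -> e2.
rewrite (metricBl hg)// (metricBr hg)//.
apply: (mulfI (lt0r_neq0 (expR_gt0 (2 * mu y)))).
by rewrite !(mulrDr, mulrBr) in e2 *; lra.
Qed.

(* Koszul's argument, applied to the difference of the two connections. *)
Lemma conformal_connectionE B y v : U y -> tangent y v -> vector_field U B ->
  nablat y v B = nabla y v B + (v mu *: B y + B y mu *: v -
    g y v (B y) *: gradient g mu y).
Proof.
move=> Uy tv UB.
have [A UA <-] := extU Uy tv.
have tA : tangent y (A y) by case: UA => + _; exact.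
have tB : tangent y (B y) by case: UB => + _; exact.
have t1 := connection_tangent hnablat oU extU Uy tA UB.
have t2 := connection_tangent hnabla oU extU Uy tA UB.
have tN := gradient_tangent (mu := mu) hg hE Uy.
suff : nablat y (A y) B - nabla y (A y) B = A y mu *: B y + B y mu *: A y -
    g y (A y) (B y) *: gradient g mu y.
  by move=> <-; rewrite addrC subrK.
apply: (metric_inj hg (x := y)) => // w tw.
have [C UC Cw] := extU Uy tw; rewrite -Cw in tw *.
have t3 := connection_tangent hnablat oU extU Uy tA UC.
have t4 := connection_tangent hnabla oU extU Uy tA UC.
have t5 := connection_tangent hnablat oU extU Uy tB UC.
have t6 := connection_tangent hnabla oU extU Uy tB UC.
rewrite !(metricBl hg, metricDl hg, metricZl hg)//.
rewrite (gradientE hg hE Uy tw).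
(* For the difference [S] of the connections, symmetry leaves three unknowns [g(S(A, B), C)],
   [g(S(A, C), B)], [g(S(B, C), A)]. The three permuted identities give their pairwise sums, so a
   linear solve finishes. *)
have m1 := connection_difference_metric Uy UA UB UC.
have m2 := connection_difference_metric Uy UB UA UC.
have m3 := connection_difference_metric Uy UC UA UB.
rewrite (connection_difference_sym Uy UB UA) in m2.
rewrite (connection_difference_sym Uy UC UA) in m3.
rewrite (connection_difference_sym Uy UC UB) in m3.
rewrite !(metricBl hg, metricBr hg)// in m1 m2 m3 *.
rewrite (metricC hg tB t3) (metricC hg tB t4) in m1.
rewrite (metricC hg tA t5) (metricC hg tA t6) in m2 m3.
lra.
Qed.

End ConformalConnection.

(** * Orthogonal splitting and the trace of the tension form *)

Section ConformalMetric.
Context {R : realType} {n : nat} {M : smooth_manifold R n} {g : tensor2 M}.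
Context {mu : M -> R}.

Lemma conformal_riemannian : riemannian_metric g -> smooth_on setT mu ->
  riemannian_metric (conformal_metric mu g).
Proof.
rewrite /conformal_metric => hg hmu; split.
- by move=> x u v tu tv; rewrite (metricC hg).
- move=> x a u v w tu tv tw.
  by rewrite (metric_linear hg)// mulrDr mulrCA.
- by move=> x v tv v0; rewrite mulr_gt0 ?expR_gt0// (metric_pos hg).
- move=> U X Y oU UX UY; apply: smooth_onM => //; last exact: (metric_smooth hg).
  by apply: smooth_on_expR => //; apply: smooth_onZ => //; exact: smooth_onW hmu.
Qed.

Lemma perp_conformal S : perp (conformal_metric mu g) S = perp g S.
Proof.
apply/funext => x; apply/seteqP; split=> v [tv vS]; split=> // w Sw.
  apply: (mulfI (lt0r_neq0 (expR_gt0 (2 * mu x)))).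
  by rewrite mulr0; exact: vS.
by rewrite /conformal_metric vS// mulr0.
Qed.

Lemma ortho_proj_conformal S :
  ortho_proj (conformal_metric mu g) S = ortho_proj g S.
Proof. by rewrite /ortho_proj perp_conformal. Qed.

End ConformalMetric.

Section Splitting.
Context {R : realType} {n p q : nat} {M : smooth_manifold R n} {g : tensor2 M}.
Context {U : set M} {sigma : M -> set (vec M)}.
Context {e : 'I_p -> vfield M} {e' : 'I_q -> vfield M}.
Hypotheses (hg : riemannian_metric g) (oU : open U).
Hypothesis hsigma : smooth_distribution p sigma.
Hypothesis he : orthonormal_frame g sigma U e.
Hypothesis he' : orthonormal_frame g (perp g sigma) U e'.
Implicit Types (x y : M) (u v w : vec M) (X Y Z : vfield M).

Local Notation P := (ortho_proj g sigma).

(** [orthonormal_frame] only encloses [sigma] in a span; closure under linear combinations comes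
    from the local basis of [smooth_distribution]. *)
Lemma distribution_sum y (c : 'I_p -> R) (u : 'I_p -> vec M) :
  (forall i, sigma y (u i)) -> sigma y (\sum_(i < p) c i *: u i).
Proof.
have [V [b [[_ Vy] _ /(_ y Vy)[_ ->]]]] := hsigma y => /choice[d ud].
exists (fun j => \sum_(i < p) c i * d i j).
under eq_bigr do rewrite ud scaler_sumr.
rewrite exchange_big; apply: eq_bigr => j _; rewrite scaler_suml.
by apply: eq_bigr => i _; rewrite scalerA.
Qed.

Lemma dist_frame_field i : vector_field U (e i).
Proof. by have [/(_ i)[]] := he. Qed.

Lemma perp_frame_field j : vector_field U (e' j).
Proof. by have [/(_ j)[]] := he'. Qed.

Lemma dist_frame_in i y : U y -> sigma y (e i y).
Proof. by move=> Uy; have [/(_ i)[_ +] _] := he; exact. Qed.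

Lemma perp_frame_in j y : U y -> perp g sigma y (e' j y).
Proof. by move=> Uy; have [/(_ j)[_ +] _] := he'; exact. Qed.

Lemma dist_frame_tangent i y : U y -> tangent y (e i y).
Proof. by move=> Uy; have [+ _] := dist_frame_field i; exact. Qed.

Lemma perp_frame_tangent j y : U y -> tangent y (e' j y).
Proof. by case/(perp_frame_in j). Qed.

Lemma dist_tangent y v : U y -> sigma y v -> tangent y v.
Proof.
move=> Uy /(orthonormal_decomp hg he Uy) ->.
by have te i := dist_frame_tangent i Uy.
Qed.

Lemma proj_frame_perp y v : U y -> tangent y v ->
  perp g sigma y (v - \sum_(i < p) g y v (e i y) *: e i y).
Proof.
move=> Uy tv; have te i := dist_frame_tangent i Uy; split=> // w Sw.
have tw := dist_tangent Uy Sw.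
rewrite (metricBr hg)// (metric_sumr hg)//.
rewrite {1}(orthonormal_decomp hg he Uy Sw) (metric_suml hg)//.
apply/eqP; rewrite subr_eq0; apply/eqP/eq_bigr => i _.
rewrite (metricZr hg)// (metricZl hg)// mulrC; congr (_ * _).
exact: metricC.
Qed.

(** The frame sum is the unique admissible choice in [ortho_proj]. Linearity and smoothness of the
    projection are read off this formula. *)
Lemma projE y v : U y -> tangent y v ->
  P y v = \sum_(i < p) g y v (e i y) *: e i y.
Proof.
move=> Uy tv; have te i := dist_frame_tangent i Uy.
apply: xget_unique => [|w [Sw vw]].
  split; last exact: proj_frame_perp.
  by apply: distribution_sum => i; exact: dist_frame_in.
rewrite (orthonormal_decomp hg he Uy Sw); apply: eq_bigr => i _; congr (_ *: _).
have tw := dist_tangent Uy Sw.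
have [_ /(_ _ (dist_frame_in i Uy))/eqP] := vw.
by rewrite (metricBr hg)// subr_eq0 !(metricC hg (te i))// => /eqP.
Qed.

Lemma proj_in y v : U y -> tangent y v -> sigma y (P y v).
Proof.
move=> Uy tv; rewrite projE//.
by apply: distribution_sum => i; exact: dist_frame_in.
Qed.

Lemma proj_tangent y v : U y -> tangent y v -> tangent y (P y v).
Proof. by move=> Uy tv; exact/dist_tangent/proj_in. Qed.

Lemma proj_compl_perp y v : U y -> tangent y v -> perp g sigma y (v - P y v).
Proof. by move=> Uy tv; rewrite projE//; exact: proj_frame_perp. Qed.

(** Projecting onto the complement asks for a remainder in the double complement. A second candidate
    [w] differs from [v - P v] by a vector of the complement that also equals [P v - (v - w)]; it is
    orthogonal to both of these terms, hence null. *)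
Lemma perp_projE y v : U y -> tangent y v ->
  ortho_proj g (perp g sigma) y v = v - P y v.
Proof.
move=> Uy tv; have tP := proj_tangent Uy tv.
have [_ vP] := proj_compl_perp Uy tv.
apply: xget_unique => [|w [[tw wS] [_ vw]]].
  split; first exact: proj_compl_perp.
  rewrite opprB addrC subrK; split=> // w [tw wS].
  by rewrite (metricC hg)//; apply: wS; exact: proj_in.
have dS : perp g sigma y (w - (v - P y v)).
  split=> // u Su; have tu := dist_tangent Uy Su.
  by rewrite (metricBr hg)// wS// vP// subrr.
have [td dS0] := dS.
apply/eqP; rewrite -subr_eq0; apply/negPn/negP => d0.
have := metric_pos hg td d0.
have dE : w - (v - P y v) = P y v - (v - w).
  by rewrite !opprB addrCA.
rewrite {2}dE (metricBr hg)// vw// (metricC hg)// dS0 ?subrr ?ltxx//.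
exact: proj_in.
Qed.

Lemma projD y u v : U y -> tangent y u -> tangent y v ->
  P y (u + v) = P y u + P y v.
Proof.
move=> Uy tu tv; have te i := dist_frame_tangent i Uy.
rewrite !projE// -big_split; apply: eq_bigr => i _.
by rewrite (metricDl hg)// scalerDl.
Qed.

Lemma projZ y (a : R) v : U y -> tangent y v -> P y (a *: v) = a *: P y v.
Proof.
move=> Uy tv; have te i := dist_frame_tangent i Uy.
rewrite !projE// scaler_sumr; apply: eq_bigr => i _.
by rewrite (metricZl hg)// scalerA.
Qed.

Lemma projB y u v : U y -> tangent y u -> tangent y v ->
  P y (u - v) = P y u - P y v.
Proof. by move=> Uy tu tv; rewrite -[- v]scaleN1r projD// projZ// scaleN1r. Qed.

Lemma proj_id y v : U y -> sigma y v -> P y v = v.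
Proof.
move=> Uy Sv; rewrite projE//; last exact: dist_tangent.
by rewrite -(orthonormal_decomp hg he Uy Sv).
Qed.

Lemma proj_perp0 y v : U y -> perp g sigma y v -> P y v = 0.
Proof.
move=> Uy [tv vS]; rewrite projE//; apply: big1 => i _.
have Se := dist_frame_in i Uy; have te := dist_frame_tangent i Uy.
by rewrite (metricC hg)// vS ?scale0r.
Qed.

(** Both sides equal [g(P u, P v)]. *)
Lemma proj_symmetric y u v : U y -> tangent y u -> tangent y v ->
  g y (P y u) v = g y u (P y v).
Proof.
move=> Uy tu tv; have tPu := proj_tangent Uy tu; have tPv := proj_tangent Uy tv.
have [_ /(_ _ (proj_in Uy tu))/eqP] := proj_compl_perp Uy tv.
rewrite (metricBr hg)// subr_eq0 => /eqP ->.
have [_ /(_ _ (proj_in Uy tv))/eqP] := proj_compl_perp Uy tu.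
rewrite (metricBr hg)// subr_eq0 => /eqP.
by rewrite (metricC hg tPu tPv) (metricC hg tu tPv).
Qed.

Lemma proj_field X : vector_field U X -> vector_field U (fun y => P y (X y)).
Proof.
move=> UX.
apply: (vector_field_eq (X := fun y => \sum_(i < p) g y (X y) (e i y) *: e i y)).
  by move=> y Uy; rewrite projE//; case: UX => + _; exact.
apply: vector_field_sum => i; apply: (vector_fieldZ oU) (dist_frame_field i).
exact: (metric_smooth hg oU UX (dist_frame_field i)).
Qed.

(** The index type ['I_(p + q)] makes sums split with [big_split_ord] without casting indices. *)
Definition split_frame (k : 'I_(p + q)) : vfield M :=
  match fintype.split k with inl i => e i | inr j => e' j end.

Lemma split_frame_l i : split_frame (lshift q i) = e i.
Proof. by rewrite /split_frame (unsplitK (inl i)). Qed.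

Lemma split_frame_r j : split_frame (rshift p j) = e' j.
Proof. by rewrite /split_frame (unsplitK (inr j)). Qed.

Lemma split_frame_orthonormal :
  orthonormal_frame g (@tangent R n M) U split_frame.
Proof.
split=> [k|y Uy].
  case: (split_ordP k) => i ->; rewrite ?split_frame_l ?split_frame_r; split.
  - exact: dist_frame_field.
  - by move=> y Uy; exact: dist_frame_tangent.
  - exact: perp_frame_field.
  - by move=> y Uy; exact: perp_frame_tangent.
have te i := dist_frame_tangent i Uy; have te' j := perp_frame_tangent j Uy.
have [_ /(_ y Uy)[eON _]] := he; have [_ /(_ y Uy)[e'ON _]] := he'.
have ee' i j : g y (e i y) (e' j y) = 0.
  by have [_] := perp_frame_in j Uy; apply; exact: dist_frame_in.
split=> [k l|v tv].
  case: (split_ordP k) => i ->; case: (split_ordP l) => j ->;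
    rewrite ?split_frame_l ?split_frame_r ?eq_lshift ?eq_rshift ?eq_lrshift
      ?eq_rlshift //.
  by rewrite (metricC hg).
exists (fun k => g y v (split_frame k y)).
rewrite big_split_ord /=; under eq_bigr do rewrite split_frame_l.
rewrite -projE// addrC; under eq_bigr do rewrite split_frame_r.
rewrite -[LHS](subrK (P y v)); congr (_ + _).
have vP := proj_compl_perp Uy tv.
rewrite [LHS](orthonormal_decomp hg he' Uy vP).
apply: eq_bigr => j _; congr (_ *: _); have tP := proj_tangent Uy tv.
rewrite (metricBl hg)//.
by have [_ /(_ _ (proj_in Uy tv)) ->] := perp_frame_in j Uy; rewrite subr0.
Qed.

End Splitting.

(** * Tensoriality of the tension form and change of frame in its trace *)

Section TensionTrace.
Context {R : realType} {n p q : nat} {M : smooth_manifold R n} {g h : tensor2 M}.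
Context {U : set M} {sigma : M -> set (vec M)} {D : connection M}.
Context {e : 'I_p -> vfield M} {e' : 'I_q -> vfield M}.
Hypotheses (hg : riemannian_metric g) (oU : open U).
Hypothesis hsigma : smooth_distribution p sigma.
Hypothesis he : orthonormal_frame g sigma U e.
Hypothesis he' : orthonormal_frame g (perp g sigma) U e'.
Hypothesis hD : levi_civita h D.
Variables (x : M) (X : vfield M) (Y : vec M).
Hypotheses (Ux : U x) (UX : vector_field U X) (hY : perp g sigma x Y).

Local Notation P := (ortho_proj g sigma).
Let F := split_frame (e := e) (e' := e').
Let hF := split_frame_orthonormal hg hsigma he he'.
Let extU : extendable U := frame_extendable hg oU hF.
Let tY : tangent x Y.
Proof. by case: hY. Qed.

(* The summand of the tension field, polarised in the frame vector. *)
Definition tension_form (a : vec M) (B : vfield M) : R :=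
  g x (D x a (fun y => D y (B y) X) - D x (D x a B) X
       - 2 *: D x a (fun y => P y (D y (B y) X))) Y.

Lemma proj_pair0 v : tangent x v -> g x (P x v) Y = 0.
Proof.
move=> tv; have := proj_in hg hsigma he Ux tv => Sv.
by have [_ ->] := hY.
Qed.

Let UDX (B : vfield M) : vector_field U B -> vector_field U (fun y => D y (B y) X).
Proof. by move=> UB; exact: (lc_smooth hD oU UB UX). Qed.

Let UPDX (B : vfield M) : vector_field U B ->
  vector_field U (fun y => P y (D y (B y) X)).
Proof. by move=> UB; apply: (proj_field hg oU hsigma he); exact: UDX. Qed.

Lemma tension_form_suml (I : Type) (r : seq I) (c : I -> R) (a : I -> vec M)
    (B : vfield M) : (forall i, tangent x (a i)) -> vector_field U B ->
  tension_form (\sum_(i <- r) c i *: a i) B =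
  \sum_(i <- r) c i * tension_form (a i) B.
Proof.
move=> ta UB; have UD := UDX UB; have UPD := UPDX UB.
have t1 i := connection_tangent hD oU extU Ux (ta i) UD.
have t2 i := connection_tangent hD oU extU Ux (ta i) UB.
have t3 i := connection_tangent hD oU extU Ux (t2 i) UX.
have t4 i := connection_tangent hD oU extU Ux (ta i) UPD.
rewrite /tension_form !(connection_linl hD oU)//.
rewrite scaler_sumr -!sumrB (metric_suml hg)//.
apply: eq_bigr => i _; rewrite scalerA mulrC -scalerA.
by rewrite -!scalerBr (metricZl hg).
Qed.

Lemma tension_form_eq a (B C : vfield M) : tangent x a ->
  vector_field U B -> vector_field U C -> (forall y, U y -> B y = C y) ->
  tension_form a B = tension_form a C.
Proof.
move=> ta UB UC BC; rewrite /tension_form.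
rewrite (connection_eq hD oU Ux ta (UDX UB) (UDX UC)); last first.
  by move=> y /BC ->.
rewrite (connection_eq hD oU Ux ta UB UC)//.
rewrite (connection_eq hD oU Ux ta (UPDX UB) (UPDX UC))//.
by move=> y /BC ->.
Qed.

(** Three terms carry the derivative [a f]. Those from [D_a D_B X] and from the derivative along
    [D_a B] cancel; the third, [-2 (a f) P(D_B X)], lies in [sigma] and dies against [Y]. *)
Lemma tension_formZr a (f : M -> R) (B : vfield M) : tangent x a ->
  smooth_on U f -> vector_field U B ->
  tension_form a (fun y => f y *: B y) = f x * tension_form a B.
Proof.
move=> ta Uf UB; have UD := UDX UB; have UPD := UPDX UB.
have UfB := vector_fieldZ oU Uf UB.
have tB y : U y -> tangent y (B y) by case: UB => + _; exact.
have t1 := connection_tangent hD oU extU Ux ta UD.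
have t2 := connection_tangent hD oU extU Ux ta UB.
have t3 := connection_tangent hD oU extU Ux t2 UX.
have t4 := connection_tangent hD oU extU Ux ta UPD.
have t5 := connection_tangent hD oU extU Ux (tB x Ux) UX.
have t6 : tangent x (B x) by exact: tB.
rewrite /tension_form.
have -> : D x a (fun y => D y (f y *: B y) X) =
    a f *: D x (B x) X + f x *: D x a (fun y => D y (B y) X).
  rewrite -(lc_leibniz hD oU Ux Uf UD ta).
  apply: (connection_eq hD oU Ux ta (UDX UfB)) (vector_fieldZ oU Uf UD) _.
  by move=> y Uy; rewrite (connectionZl hD oU _ Uy UX (tB y Uy)).
have -> : D x a (fun y => P y (D y (f y *: B y) X)) =
    a f *: P x (D x (B x) X) + f x *: D x a (fun y => P y (D y (B y) X)).
  rewrite -(lc_leibniz hD oU Ux Uf UPD ta).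
  apply: (connection_eq hD oU Ux ta (UPDX UfB)) (vector_fieldZ oU Uf UPD) _.
  move=> y Uy; rewrite (connectionZl hD oU _ Uy UX (tB y Uy)).
  have tD := connection_tangent hD oU extU Uy (tB y Uy) UX.
  by rewrite (projZ hg hsigma he _ Uy tD).
rewrite (lc_leibniz hD oU Ux Uf UB ta) (connectionDl hD oU)//.
rewrite !(connectionZl hD oU)//.
have t7 := proj_tangent hg hsigma he Ux t5.
rewrite !(metricBl hg)// !(metricDl hg, metricZl hg)//.
by rewrite proj_pair0//; ring.
Qed.

Lemma tension_form_sumr a (I : Type) (r : seq I) (B : I -> vfield M) :
  tangent x a -> (forall i, vector_field U (B i)) ->
  tension_form a (fun y => \sum_(i <- r) B i y) =
  \sum_(i <- r) tension_form a (B i).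
Proof.
move=> ta UB; have UD i := UDX (UB i); have UPD i := UPDX (UB i).
have UsB := vector_field_sum r UB.
have tB i y : U y -> tangent y (B i y) by case: (UB i) => + _; exact.
have t1 i := connection_tangent hD oU extU Ux ta (UD i).
have t2 i := connection_tangent hD oU extU Ux ta (UB i).
have t3 i := connection_tangent hD oU extU Ux (t2 i) UX.
have t4 i := connection_tangent hD oU extU Ux ta (UPD i).
rewrite /tension_form.
have -> : D x a (fun y => D y (\sum_(i <- r) B i y) X) =
    \sum_(i <- r) D x a (fun y => D y (B i y) X).
  rewrite -(connection_sumr hD oU r Ux ta UD).
  apply: (connection_eq hD oU Ux ta (UDX UsB)) (vector_field_sum r UD) _.
  by move=> y Uy; rewrite (connection_suml hD oU r Uy UX (fun i => tB i y Uy)).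
have -> : D x a (fun y => P y (D y (\sum_(i <- r) B i y) X)) =
    \sum_(i <- r) D x a (fun y => P y (D y (B i y) X)).
  rewrite -(connection_sumr hD oU r Ux ta UPD).
  apply: (connection_eq hD oU Ux ta (UPDX UsB)) (vector_field_sum r UPD) _.
  move=> y Uy; rewrite (connection_suml hD oU r Uy UX (fun i => tB i y Uy)).
  have tD i := connection_tangent hD oU extU Uy (tB i y Uy) UX.
  elim: r {UsB} => [|i r IH]; last first.
    by rewrite !big_cons (projD hg hsigma he)// IH.
  rewrite !big_nil -[0 in LHS](scale0r 0) (projZ hg hsigma he)//.
  exact: scale0r.
rewrite (connection_sumr hD oU r Ux ta UB) (connection_suml hD oU)//.
by rewrite scaler_sumr -!sumrB (metric_suml hg).
Qed.

(** Expand the second slot of [T(Z_i, Z_i)] in the adapted frame, then resum over [i] in the first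
    slot. The hypothesis is the completeness relation of [Z], up to the factor [lambda] that
    measures its normalisation with respect to [g]. *)
Lemma tension_form_trace m (Z : 'I_m -> vfield M) (lambda : R) :
  (forall i, vector_field U (Z i)) ->
  (forall k, \sum_(i < m) g x (Z i x) (F k x) *: Z i x = lambda *: F k x) ->
  \sum_(i < m) tension_form (Z i x) (Z i) =
  lambda * \sum_k tension_form (F k x) (F k).
Proof.
move=> UZ ZF; have [sF _] := hF.
have UF k : vector_field U (F k) by case: (sF k).
have tF k : tangent x (F k x) by have [+ _] := UF k; exact.
have tZ i : tangent x (Z i x) by have [+ _] := UZ i; exact.
have gZF i k := metric_smooth hg oU (UZ i) (UF k).
have UZF i k := vector_fieldZ oU (gZF i k) (UF k).
have -> : \sum_(i < m) tension_form (Z i x) (Z i) =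
    \sum_(i < m) \sum_k g x (Z i x) (F k x) * tension_form (Z i x) (F k).
  apply: eq_bigr => i _.
  rewrite (tension_form_eq (tZ i) (UZ i)
    (vector_field_sum (index_enum 'I_(p + q)) (UZF i))); last first.
    move=> y Uy; apply: (orthonormal_decomp hg hF Uy).
    by have [+ _] := UZ i; exact.
  rewrite tension_form_sumr//; apply: eq_bigr => k _.
  by rewrite tension_formZr.
rewrite exchange_big mulr_sumr; apply: eq_bigr => k _.
rewrite -tension_form_suml// ZF.
(* A one-term sum extracts the scalar from the first slot. *)
have := @tension_form_suml _ [:: tt] (fun=> lambda) (fun=> F k x) (F k).
by rewrite !big_seq1; apply.
Qed.

(** The outer projection removes a vector of [sigma], which is invisible to [Y]; the pairing can
    then be distributed over the summands. *)
Lemma tension_pair m (Z : 'I_m -> vfield M) :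
  (forall i, vector_field U (Z i)) ->
  g x (ortho_proj g (perp g sigma) x
    (\sum_(i < m) (second_derivative D X (Z i) x
       - 2 *: D x (Z i x) (fun y => P y (D y (Z i y) X))))) Y =
  \sum_(i < m) tension_form (Z i x) (Z i).
Proof.
move=> UZ; have tZ i : tangent x (Z i x) by have [+ _] := UZ i; exact.
have UD i := UDX (UZ i); have UPD i := UPDX (UZ i).
have t1 i := connection_tangent hD oU extU Ux (tZ i) (UD i).
have t2 i := connection_tangent hD oU extU Ux (tZ i) (UZ i).
have t3 i := connection_tangent hD oU extU Ux (t2 i) UX.
have t4 i := connection_tangent hD oU extU Ux (tZ i) (UPD i).
set W := \sum_(i < m) _.
have tW : tangent x W by apply: tangent_sum => i _; rewrite /second_derivative.
have tPW := proj_tangent hg hsigma he Ux tW.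
rewrite (perp_projE hg hsigma he)// (metricBl hg)// proj_pair0// subr0.
by rewrite (metric_suml hg)// => i; rewrite /second_derivative.
Qed.

End TensionTrace.

(** * Comparison of the two tension forms *)

Section TensionComparison.
Context {R : realType} {n p q : nat} {M : smooth_manifold R n} {g : tensor2 M}.
Context {U : set M} {sigma : M -> set (vec M)} {mu : M -> R}.
Context {nabla nablat : connection M}.
Context {e : 'I_p -> vfield M} {e' : 'I_q -> vfield M}.
Hypotheses (hg : riemannian_metric g) (oU : open U).
Hypothesis hmu : smooth_on setT mu.
Hypothesis hnabla : levi_civita g nabla.
Hypothesis hnablat : levi_civita (conformal_metric mu g) nablat.
Hypothesis hsigma : smooth_distribution p sigma.
Hypothesis he : orthonormal_frame g sigma U e.
Hypothesis he' : orthonormal_frame g (perp g sigma) U e'.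
Variables (x : M) (X : vfield M) (Y : vec M).
Hypotheses (Ux : U x) (hX : section_of sigma U X) (hY : perp g sigma x Y).

Local Notation P := (ortho_proj g sigma).
Local Notation N := (gradient g mu).
Local Notation Ntop := (fun y => P y (N y)).
Local Notation tau_form := (@tension_form R n M g sigma nabla x X Y).
Local Notation taut_form := (@tension_form R n M g sigma nablat x X Y).
Let hF := split_frame_orthonormal hg hsigma he he'.
Let extU : extendable U := frame_extendable hg oU hF.
Let UX : vector_field U X. Proof. by case: hX. Qed.
Let tY : tangent x Y.
Proof. by case: hY. Qed.
Let tX y : U y -> tangent y (X y).
Proof. by move=> Uy; have [+ _] := UX; exact. Qed.
Let Umu : smooth_on U mu. Proof. exact: smooth_onW hmu. Qed.
Let UN : vector_field U N. Proof. exact: (gradient_field hg oU hF Umu). Qed.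
Let UNtop : vector_field U Ntop.
Proof. exact: (proj_field hg oU hsigma he UN). Qed.
Let tN y : U y -> tangent y (N y). Proof. exact: (gradient_tangent hg hF). Qed.
Let Nmu y v : U y -> tangent y v -> g y (N y) v = v mu.
Proof. exact: (gradientE hg hF). Qed.
Let Udmu A : vector_field U A -> smooth_on U (fun y => A y mu).
Proof. by case=> _; apply. Qed.
Let gXY : g x (X x) Y = 0.
Proof. by have [_ ->] := hY => //; case: hX => _; exact. Qed.

(** Terms are grouped by origin: the derivative of the correction in [nablat_A X]; the same for its
    projection, with factor 2; the three corrections of the outer derivative, each joined with its
    projected counterpart; finally the derivative along [nablat_A A]. Vectors of [sigma] have
    already dropped out against [Y]. *)
Lemma conformal_tension_form (A : vfield M) : vector_field U A ->
  let Atop := fun y => P y (A y) in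
  let DX := nabla x (A x) X in
  taut_form (A x) A = tau_form (A x) A
  + (A x mu * g x DX Y + A x (fun y => X y mu) * g x (A x) Y
     + X x mu * g x (nabla x (A x) A) Y
     - (g x (nabla x (A x) A) (X x) + g x (A x) DX) * Y mu
     - g x (A x) (X x) * g x (nabla x (A x) N) Y)
  - 2 * (A x mu * g x DX Y + X x mu * g x (nabla x (A x) Atop) Y
     - g x (A x) (X x) * g x (nabla x (A x) Ntop) Y)
  + A x mu * (g x DX Y + X x mu * g x (A x) Y - g x (A x) (X x) * Y mu)
  + g x (A x) Y * (DX mu + A x mu * X x mu + X x mu * A x mu
       - g x (A x) (X x) * N x mu
     - 2 * (P x DX mu + A x mu * X x mu + X x mu * Atop x mu
       - g x (A x) (X x) * Ntop x mu))
  - Y mu * (g x (A x) DX + A x mu * g x (A x) (X x) + X x mu * g x (A x) (A x)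
       - g x (A x) (X x) * A x mu
     - 2 * (g x (A x) (P x DX) + A x mu * g x (A x) (X x)
       + X x mu * g x (A x) (Atop x) - g x (A x) (X x) * g x (A x) (Ntop x)))
  - (2 * A x mu * g x DX Y - g x (A x) (A x) * g x (nabla x (N x) X) Y
     + X x mu * (g x (nabla x (A x) A) Y + 2 * A x mu * g x (A x) Y
       - g x (A x) (A x) * Y mu)
     - Y mu * (g x (nabla x (A x) A) (X x) + 2 * A x mu * g x (A x) (X x)
       - g x (A x) (A x) * X x mu)).
Proof.
move=> UA Atop DX.
have tA y : U y -> tangent y (A y) by case: UA => + _; exact.
have UAtop : vector_field U Atop by exact: (proj_field hg oU hsigma he UA).
have UgAX : smooth_on U (fun y => g y (A y) (X y)) by exact: (metric_smooth hg).
have UAmu := Udmu UA; have UXmu := Udmu UX.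
pose B := fun y => nabla y (A y) X; pose Btop := fun y => P y (B y).
pose Bt := fun y => nablat y (A y) X; pose Bttop := fun y => P y (Bt y).
have UB : vector_field U B := lc_smooth hnabla oU UA UX.
have UBtop : vector_field U Btop := proj_field hg oU hsigma he UB.
have UBt : vector_field U Bt := lc_smooth hnablat oU UA UX.
have UBttop : vector_field U Bttop := proj_field hg oU hsigma he UBt.
(* [W] and [Wtop] are [Bt] and [Bttop] written through [nabla]. They agree on [U], which suffices
   under a derivative by [connection_eq]. *)
pose W y := B y + (A y mu *: X y + X y mu *: A y - g y (A y) (X y) *: N y).
pose Wtop y := Btop y + (A y mu *: X y + X y mu *: Atop y
  - g y (A y) (X y) *: Ntop y).
have tB y : U y -> tangent y (B y) by case: UB => + _; exact.
have UW : vector_field U W.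
  apply: (vector_fieldD UB); apply: vector_fieldD; last first.
    by apply: vector_fieldN => //; exact: vector_fieldZ.
  by apply: vector_fieldD; exact: vector_fieldZ.
have BtE y : U y -> Bt y = W y.
  by move=> Uy; exact: (conformal_connectionE hg oU hF hmu hnabla hnablat Uy (tA y Uy) UX).
have BttopE y : U y -> Bttop y = Wtop y.
  move=> Uy; have tAy := tA y Uy; have tXy := tX Uy; have tNy := tN Uy.
  have tBy := tB y Uy.
  rewrite /Bttop BtE// /W (projD hg hsigma he)// (projB hg hsigma he)//.
  rewrite (projD hg hsigma he)// !(projZ hg hsigma he)//.
  by rewrite (proj_id hg hsigma he Uy (v := X y))//; case: hX => _; exact.
have UWtop := vector_field_eq BttopE UBttop.
have tAx := tA x Ux; have tXx := tX Ux; have tNx := tN Ux.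
have tBx := tB x Ux.
have tAt : tangent x (Atop x) by exact: (proj_tangent hg hsigma he).
have tNt : tangent x (Ntop x) by exact: (proj_tangent hg hsigma he).
have tBt : tangent x (Btop x) by exact: (proj_tangent hg hsigma he).
have tDB := connection_tangent hnabla oU extU Ux tAx UB.
have tDBtop := connection_tangent hnabla oU extU Ux tAx UBtop.
have tDA := connection_tangent hnabla oU extU Ux tAx UA.
have tDN := connection_tangent hnabla oU extU Ux tAx UN.
have tDNtop := connection_tangent hnabla oU extU Ux tAx UNtop.
have tDAtop := connection_tangent hnabla oU extU Ux tAx UAtop.
have tDAX := connection_tangent hnabla oU extU Ux tDA UX.
have tDNX := connection_tangent hnabla oU extU Ux tNx UX.
have tDX : tangent x (nabla x (A x) X) by [].
have tW : tangent x (W x) by rewrite /W.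
have tWtop : tangent x (Wtop x) by rewrite /Wtop.
have NtopY : g x (Ntop x) Y = 0 by exact: (proj_pair0 hg hsigma he).
have AtopY : g x (Atop x) Y = 0 by exact: (proj_pair0 hg hsigma he).
have BtopY : g x (Btop x) Y = 0 by exact: (proj_pair0 hg hsigma he).
have NY : g x (N x) Y = Y mu by exact: Nmu.
have NA : g x (A x) (N x) = A x mu by rewrite (metricC hg)//; exact: Nmu.
have NX : g x (N x) (X x) = X x mu by exact: Nmu.
have DgAX : A x (fun y => g y (A y) (X y)) =
    g x (nabla x (A x) A) (X x) + g x (A x) DX.
  exact: (lc_metric hnabla oU Ux UA UX tAx).
have conf Z v : tangent x v -> vector_field U Z -> nablat x v Z = _ :=
  conformal_connectionE hg oU hF hmu hnabla hnablat Ux.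
have e1 : nablat x (A x) Bt = nabla x (A x) W +
    (A x mu *: W x + W x mu *: A x - g x (A x) (W x) *: N x).
  by rewrite (connection_eq hnablat oU Ux tAx UBt UW BtE) conf.
have e2 : nablat x (A x) Bttop = nabla x (A x) Wtop +
    (A x mu *: Wtop x + Wtop x mu *: A x - g x (A x) (Wtop x) *: N x).
  by rewrite (connection_eq hnablat oU Ux tAx UBttop UWtop BttopE) conf.
have tDtA := connection_tangent hnablat oU extU Ux tAx UA.
have e3 : nablat x (nablat x (A x) A) X =
    nabla x (nablat x (A x) A) X + (nablat x (A x) A mu *: X x +
      X x mu *: nablat x (A x) A - g x (nablat x (A x) A) (X x) *: N x).
  by rewrite conf.
have e4 : nablat x (A x) A = nabla x (A x) A +
    (A x mu *: A x + A x mu *: A x - g x (A x) (A x) *: N x).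
  by rewrite conf.
have e5 : nabla x (nablat x (A x) A) X = nabla x (nabla x (A x) A) X +
    (A x mu *: DX + A x mu *: DX - g x (A x) (A x) *: nabla x (N x) X).
  rewrite e4 -!scaleNr !(connectionDl hnabla oU)//.
  by rewrite !(connectionZl hnabla oU).
rewrite /tension_form e1 e2 e3 e5 e4.
rewrite (connection_comb hnabla oU Ux tAx UAmu UXmu UgAX UB UX UA UN).
rewrite (connection_comb hnabla oU Ux tAx UAmu UXmu UgAX UBtop UX UAtop UNtop).
rewrite -/B -/Btop DgAX /W /Wtop.
rewrite !(metricDl hg, metricNl hg, metricZl hg)//.
rewrite !(metricDr hg, metricNr hg, metricZr hg)//.
rewrite !(vec_addE, vec_oppE, vec_scaleE) NtopY AtopY BtopY gXY NY NA NX.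
rewrite -[B x]/DX -[Btop x]/(P x DX) -/DX.
ring.
Qed.

(** For a unit section [A] of [sigma] the general formula collapses by [P A = A], [g(A, Y) = 0] and
    [g(A, P v) = g(A, v)]. *)
Lemma conformal_tension_dist i :
  let A := e i in let DX := nabla x (A x) X in
  taut_form (A x) A = tau_form (A x) A
  + g x (nabla x (N x) X) Y + X x mu * Y mu
  - 2 * X x mu * g x (nabla x (A x) A) Y - 2 * (A x mu * g x DX Y)
  - g x (A x) (X x) * g x (nabla x (A x) N) Y
  + 2 * (g x (A x) (X x) * g x (nabla x (A x) Ntop) Y)
  + Y mu * (A x mu * g x (A x) (X x)).
Proof.
move=> A DX; have UA : vector_field U A := dist_frame_field he i.
have SA : forall y, U y -> sigma y (A y) := dist_frame_in he i.
have tA : tangent x (A x) := dist_tangent hg he Ux (SA x Ux).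
have tX' := tX Ux; have tN' := tN Ux.
have tDX : tangent x DX := connection_tangent hnabla oU extU Ux tA UX.
have tPN := proj_tangent hg hsigma he Ux tN'.
have tPDX := proj_tangent hg hsigma he Ux tDX.
rewrite (conformal_tension_form UA) -/DX.
have Aid y : U y -> P y (A y) = A y by move=> Uy; exact: (proj_id hg hsigma he Uy (SA y Uy)).
rewrite (connection_eq hnabla oU Ux tA (proj_field hg oU hsigma he UA) UA Aid).
rewrite Aid//.
have gAA : g x (A x) (A x) = 1.
  by have [_ /(_ x Ux)[-> _]] := he; rewrite eqxx.
have gAY : g x (A x) Y = 0 by have [_ ->] := hY => //; exact: SA.
have PA v : tangent x v -> g x (A x) (P x v) = g x (A x) v.
  by move=> tv; rewrite -(proj_symmetric hg hsigma he)// Aid.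
have gAN : g x (A x) (N x) = A x mu by rewrite (metricC hg)//; exact: Nmu.
rewrite !PA// gAA gAY gAN.
ring.
Qed.

(** Here [P A = 0] and [g(A, X) = 0] on [U]. Differentiating the latter along [A] turns
    [g(A, nabla_A X)] into [- g(nabla_A A, X)], the source of the mean curvature of the
    complement. *)
Lemma conformal_tension_perp j :
  let A := e' j in let DX := nabla x (A x) X in
  taut_form (A x) A = tau_form (A x) A
  + g x (nabla x (N x) X) Y - X x mu * Y mu - 2 * (A x mu * g x DX Y)
  + g x (A x) Y * (A x (fun y => X y mu) + DX mu - 2 * P x DX mu)
  - X x mu * (A x mu * g x (A x) Y)
  + 2 * Y mu * g x (nabla x (A x) A) (X x).
Proof.
move=> A DX; have UA : vector_field U A := perp_frame_field he' j.
have SA : forall y, U y -> perp g sigma y (A y) := perp_frame_in he' j.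
have tA : tangent x (A x) by case: (SA x Ux).
have tX' := tX Ux; have tN' := tN Ux.
have tDX : tangent x DX := connection_tangent hnabla oU extU Ux tA UX.
have tPN := proj_tangent hg hsigma he Ux tN'.
have tPDX := proj_tangent hg hsigma he Ux tDX.
have tDA := connection_tangent hnabla oU extU Ux tA UA.
rewrite (conformal_tension_form UA) -/DX.
have A0 y : U y -> P y (A y) = 0 by move=> Uy; exact: (proj_perp0 hg hsigma he Uy (SA y Uy)).
rewrite (connection_eq hnabla oU Ux tA (proj_field hg oU hsigma he UA)
  (vector_field0 U) A0) A0//.
have D0 := connection0r hnabla oU Ux tA.
have gAA : g x (A x) (A x) = 1.
  by have [_ /(_ x Ux)[-> _]] := he'; rewrite eqxx.
have gAX y : U y -> g y (A y) (X y) = 0.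
  move=> Uy; have tAy : tangent y (A y) by case: (SA y Uy).
  rewrite (metricC hg)//; last exact: tX.
  by have [_ ->] := SA y Uy => //; case: hX => _; exact.
have PA v : tangent x v -> g x (A x) (P x v) = 0.
  by move=> tv; rewrite -(proj_symmetric hg hsigma he)// A0// (metric0l hg).
have gAY0 : g x 0 Y = 0 := metric0l hg tY.
have gA0 : g x (A x) 0 = 0 by rewrite (metricC hg)// (metric0l hg).
have DgAX : g x (A x) DX = - g x (nabla x (A x) A) (X x).
  apply/eqP; rewrite -addr_eq0 addrC -(lc_metric hnabla oU Ux UA UX tA).
  by rewrite (tangent_local (conj oU Ux) gAX tA) (tangent_cst _ tA).
rewrite D0 !PA// gAA gAX// gAY0 gA0 DgAX.
rewrite (_ : (0 : vec M) mu = 0)//.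
ring.
Qed.

(** Torsion-freeness is evaluated on [mu] itself. With [B(mu) = g(N, B)], metric compatibility
    expands both second derivatives, and the terms [g(N, nabla_A B)] and [g(N, nabla_B A)]
    cancel. *)
Lemma hessian_sym v u : tangent x v -> tangent x u ->
  g x (nabla x v N) u = g x (nabla x u N) v.
Proof.
move=> tv tu; have [A UA Av] := extU Ux tv; have [B UB Bu] := extU Ux tu.
rewrite -Av -Bu in tv tu *.
have tDAN := connection_tangent hnabla oU extU Ux tv UN.
have tDBN := connection_tangent hnabla oU extU Ux tu UN.
have tDAB := connection_tangent hnabla oU extU Ux tv UB.
have tDBA := connection_tangent hnabla oU extU Ux tu UA.
have := lc_torsion_free hnabla oU Ux UA UB Umu.
have NB C y : vector_field U C -> U y -> C y mu = g y (N y) (C y).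
  by move=> [tC _] Uy; rewrite Nmu//; exact: tC.
rewrite (tangent_local (conj oU Ux) (NB B ^~ UB) tv).
rewrite (tangent_local (conj oU Ux) (NB A ^~ UA) tu).
rewrite (lc_metric hnabla oU Ux UN UB tv) (lc_metric hnabla oU Ux UN UA tu).
rewrite !Nmu// vec_addE vec_oppE => /eqP.
by rewrite opprD addrACA -subr_eq subrr eq_sym subr_eq0 => /eqP.
Qed.

Lemma pair_linl (I : Type) (r : seq I) (c : I -> R) (F : I -> vec M) w :
  (forall i, tangent x (F i)) -> tangent x w ->
  \sum_(i <- r) c i * g x (F i) w = g x (\sum_(i <- r) c i *: F i) w.
Proof.
move=> tF tw; rewrite (metric_suml hg)//.
by apply: eq_bigr => i _; rewrite (metricZl hg).
Qed.

Lemma connection_pair_linl (I : Type) (r : seq I) (c : I -> R)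
    (F : I -> vec M) (Z : vfield M) w :
  (forall i, tangent x (F i)) -> tangent x w -> vector_field U Z ->
  \sum_(i <- r) c i * g x (nabla x (F i) Z) w =
  g x (nabla x (\sum_(i <- r) c i *: F i) Z) w.
Proof.
move=> tF tw UZ; rewrite (connection_linl hnabla oU)// pair_linl// => i.
exact: (connection_tangent hnabla oU extU).
Qed.

(** Each of the [p + q] frame vectors contributes one [g(nabla_N X, Y)], while the terms
    [-2 A(mu) g(nabla_A X, Y)] resum over both families to [-2 g(nabla_N X, Y)]. For the product of
    [X(mu)] and [Y(mu)] the two families give [p + 1] and [-(q + 1)]. *)
Lemma conformal_tension_sum :
  let F := split_frame (e := e) (e' := e') in
  \sum_k taut_form (F k x) (F k) = \sum_k tau_form (F k x) (F k)
    + (p%:R - q%:R) * (X x mu) * (Y mu)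
    - 2 * (X x mu) * g x (mean_curvature g nabla (perp g sigma) e x) Y
    + 2 * (Y mu) * g x (mean_curvature g nabla sigma e' x) (X x)
    - 2 * g x (nabla x Y (fun y => ortho_proj g (perp g sigma) y (N y))) (X x)
    + 2 * g x (nabla x (X x) Ntop) Y
    + ((p + q)%:R - 2) * g x (nabla x (N x) X) Y.
Proof.
move=> F; rewrite !big_split_ord /=.
have te i : tangent x (e i x) := dist_frame_tangent he i Ux.
have te' j : tangent x (e' j x) := perp_frame_tangent he' j Ux.
have tX' := tX Ux; have tN' := tN Ux.
have tPN := proj_tangent hg hsigma he Ux tN'.
have SX : sigma x (X x) by case: hX => _; exact.
have XE := orthonormal_decomp hg he Ux SX.
have YE := orthonormal_decomp hg he' Ux hY.
have eX i : g x (e i x) (X x) = g x (X x) (e i x) := metricC hg (te i) tX'.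
have e'Y j : g x (e' j x) Y = g x Y (e' j x) := metricC hg (te' j) tY.
have PNE : P x (N x) = \sum_i (e i x mu) *: e i x.
  rewrite (projE hg hsigma he)//.
  by apply: eq_bigr => i _; rewrite Nmu.
have QNE : N x - P x (N x) = \sum_j (e' j x mu) *: e' j x.
  rewrite [LHS](orthonormal_decomp hg he' Ux (proj_compl_perp hg hsigma he Ux tN')).
  apply: eq_bigr => j _; rewrite (metricBl hg)// Nmu//.
  by rewrite (proj_pair0 hg hsigma he Ux (perp_frame_in he' j Ux))// subr0.
have s1 : \sum_i e i x mu * g x (nabla x (e i x) X) Y = g x (nabla x (P x (N x)) X) Y.
  by rewrite connection_pair_linl// -PNE.
have s2 Z : vector_field U Z ->
    \sum_i g x (e i x) (X x) * g x (nabla x (e i x) Z) Y = g x (nabla x (X x) Z) Y.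
  by move=> UZ; under eq_bigr do rewrite eX; rewrite connection_pair_linl// -XE.
have s4 : \sum_i e i x mu * g x (e i x) (X x) = X x mu.
  under eq_bigr do rewrite eX mulrC.
  rewrite [in RHS]XE fct_sumE; exact: eq_bigr.
have s5 : \sum_i g x (nabla x (e i x) (e i)) Y =
    g x (mean_curvature g nabla (perp g sigma) e x) Y.
  have tD i := connection_tangent hnabla oU extU Ux (te i) (dist_frame_field he i).
  have tPD i := proj_tangent hg hsigma he Ux (tD i).
  rewrite /mean_curvature; under [in RHS]eq_bigr do
    rewrite (perp_projE hg hsigma he)//.
  rewrite (metric_suml hg)//; apply: eq_bigr => i _.
  by rewrite (metricBl hg)// (proj_pair0 hg hsigma he Ux hY)// subr0.
have s6 : \sum_j e' j x mu * g x (nabla x (e' j x) X) Y =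
    g x (nabla x (N x - P x (N x)) X) Y.
  by rewrite connection_pair_linl// -QNE.
have tDX v : tangent x v -> tangent x (nabla x v X).
  by move=> tv; exact: (connection_tangent hnabla oU extU).
(* Symmetry of [P] turns the value of a projected vector on [mu] into a pairing with [P N], whose
   linearity in [v] is what [s7] sums. *)
have Pmu v : tangent x v -> P x v mu = g x (P x (N x)) v.
  move=> tv; rewrite (proj_symmetric hg hsigma he)// Nmu//.
  exact: (proj_tangent hg hsigma he).
have s7 : \sum_j g x (e' j x) Y * (e' j x (fun y => X y mu)
      + nabla x (e' j x) X mu - 2 * P x (nabla x (e' j x) X) mu) =
    Y (fun y => X y mu) + nabla x Y X mu - 2 * P x (nabla x Y X) mu.
  have YD : nabla x Y X = \sum_j g x Y (e' j x) *: nabla x (e' j x) X.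
    by rewrite [in LHS]YE (connection_linl hnabla oU).
  have tYX := tDX Y tY; have tjX j := tDX _ (te' j).
  rewrite Pmu//.
  under eq_bigr do rewrite Pmu// e'Y mulrBr mulrDr mulrCA.
  rewrite sumrB big_split/= -mulr_sumr; congr (_ + _ - 2 * _).
  - by rewrite [in RHS]YE fct_sumE; exact: eq_bigr.
  - by rewrite YD fct_sumE; exact: eq_bigr.
  - rewrite YD (metric_sumr hg)//.
    by apply: eq_bigr => j _; rewrite (metricZr hg).
have s8 : \sum_j e' j x mu * g x (e' j x) Y = Y mu.
  under eq_bigr do rewrite e'Y mulrC.
  rewrite [in RHS]YE fct_sumE; exact: eq_bigr.
have s9 : \sum_j g x (nabla x (e' j x) (e' j)) (X x) =
    g x (mean_curvature g nabla sigma e' x) (X x).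
  have tD j := connection_tangent hnabla oU extU Ux (te' j) (perp_frame_field he' j).
  have tPD j := proj_tangent hg hsigma he Ux (tD j).
  rewrite /mean_curvature (metric_suml hg)//; apply: eq_bigr => j _.
  by rewrite (proj_symmetric hg hsigma he)// (proj_id hg hsigma he Ux SX).
pose Nbot y := ortho_proj g (perp g sigma) y (N y).
have NbotE y : U y -> Nbot y = N y - P y (N y).
  by move=> Uy; rewrite /Nbot (perp_projE hg hsigma he)//; exact: tN.
have UNbot : vector_field U Nbot.
  apply: (vector_field_eq (X := fun y => N y - P y (N y))).
    by move=> y /NbotE.
  by apply: vector_fieldD => //; exact: vector_fieldN.
have NbotX y : U y -> g y (Nbot y) (X y) = 0.
  move=> Uy; have [tb bS] : perp g sigma y (Nbot y).
    by rewrite NbotE//; apply: (proj_compl_perp hg hsigma he) => //; exact: tN.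
  have tXy := tX Uy.
  by rewrite (metricC hg)// bS//; case: hX => _; exact.
have tYX := tDX Y tY.
(* Differentiating [g(Nbot, X) = 0] along [Y] leaves [- g(Nbot, nabla_Y X)], and
   [Nbot = N - P N]. *)
have h1 : g x (nabla x Y Nbot) (X x) = P x (nabla x Y X) mu - nabla x Y X mu.
  have := lc_metric hnabla oU Ux UNbot UX tY.
  rewrite (tangent_local (conj oU Ux) NbotX tY) (tangent_cst _ tY) NbotE//.
  rewrite (metricBl hg)// Nmu// -Pmu// => /eqP.
  by rewrite eq_sym addr_eq0 opprB => /eqP.
have h2 : Y (fun y => X y mu) = g x (nabla x (X x) N) Y + nabla x Y X mu.
  rewrite (tangent_local (conj oU Ux) (h := fun y => g y (N y) (X y)) _ tY).
    by rewrite (lc_metric hnabla oU Ux UN UX tY) Nmu// hessian_sym.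
  by move=> y Uy; rewrite Nmu//; exact: tX.
have h3 : g x (nabla x (N x - P x (N x)) X) Y =
    g x (nabla x (N x) X) Y - g x (nabla x (P x (N x)) X) Y.
  have tNX := tDX _ tN'; have tPX := tDX _ tPN.
  rewrite -scaleN1r (connectionDl hnabla oU)// (connectionZl hnabla oU)//.
  by rewrite scaleN1r (metricBl hg).
(* Constants become sums as well, so that [E1] and [E2] can be checked summand by summand. *)
have cstE m (c : R) : m%:R * c = \sum_(i < m) c.
  by rewrite sumr_const card_ord mulr_natl.
have E1 : \sum_i taut_form (F (lshift q i) x) (F (lshift q i)) =
    \sum_i tau_form (F (lshift q i) x) (F (lshift q i))
    + p%:R * g x (nabla x (N x) X) Y + p%:R * (X x mu * Y mu)
    - 2 * X x mu * g x (mean_curvature g nabla (perp g sigma) e x) Y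
    - 2 * g x (nabla x (P x (N x)) X) Y - g x (nabla x (X x) N) Y
    + 2 * g x (nabla x (X x) Ntop) Y + Y mu * X x mu.
  (* Only the last [X x mu] arises from the sum [s4]; the earlier ones are common factors. The same
     holds below for the second [Y mu] and [s8]. *)
  rewrite -s1 -(s2 N UN) -(s2 _ UNtop) -{3}s4 -s5.
  rewrite !mulr_sumr !(cstE p).
  rewrite -!(big_split, sumrB) /=; apply: eq_bigr => i _.
  by rewrite /F split_frame_l conformal_tension_dist.
have E2 : \sum_j taut_form (F (rshift p j) x) (F (rshift p j)) =
    \sum_j tau_form (F (rshift p j) x) (F (rshift p j))
    + q%:R * g x (nabla x (N x) X) Y - q%:R * (X x mu * Y mu)
    - 2 * g x (nabla x (N x - P x (N x)) X) Y
    + (Y (fun y => X y mu) + nabla x Y X mu - 2 * P x (nabla x Y X) mu)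
    - X x mu * Y mu + 2 * Y mu * g x (mean_curvature g nabla sigma e' x) (X x).
  rewrite -s6 -s7 -{2}s8 -s9.
  rewrite !mulr_sumr !(cstE q).
  rewrite -!(big_split, sumrB) /=; apply: eq_bigr => j _.
  by rewrite /F split_frame_r conformal_tension_perp.
rewrite E1 E2 h1 h2 h3 natrD.
ring.
Qed.

End TensionComparison.

(** * Passage from the given frames to the adapted one *)

Theorem theorem4p1 (R : realType) (n p q : nat) (M : smooth_manifold R n)
  (g : tensor2 M) (hg : riemannian_metric g)
  (nabla : connection M) (hnabla : levi_civita g nabla)
  (mu : M -> R) (hmu : smooth_on setT mu)
  (nablat : connection M) (hnablat : levi_civita (conformal_metric mu g) nablat)
  (sigma : M -> set (vec M)) (hsigma : smooth_distribution p sigma)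
  (hpq : n = (p + q)%N)
  (* the point x and a neighbourhood U of it carrying the local frames *)
  (x : M) (U : set M) (hU : open_nbhs x U)
  (e : 'I_p -> vfield M) (he : orthonormal_frame g sigma U e)
  (e' : 'I_q -> vfield M) (he' : orthonormal_frame g (perp g sigma) U e')
  (E : 'I_n -> vfield M) (hE : orthonormal_frame g (@tangent R n M) U E)
  (Et : 'I_n -> vfield M)
  (hEt : orthonormal_frame (conformal_metric mu g) (@tangent R n M) U Et)
  (X : vfield M) (hX : section_of sigma U X)
  (Y : vec M) (hY : perp g sigma x Y) :
  let N := gradient g mu in
  let Ntop := fun y => ortho_proj g sigma y (N y) in
  let Nbot := fun y => ortho_proj g (perp g sigma) y (N y) in
  let Hsigma := mean_curvature g nabla (perp g sigma) e in
  let Hperp := mean_curvature g nabla sigma e' in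
  let tau := vertical_tension g nabla sigma E X in
  let taut := vertical_tension (conformal_metric mu g) nablat sigma Et X in
  expR (2 * mu x) * g x (taut x) Y =
    g x (tau x) Y
    + (p%:R - q%:R) * g x (N x) (X x) * g x (N x) Y
    - 2 * g x (N x) (X x) * g x (Hsigma x) Y
    + 2 * g x (N x) Y * g x (Hperp x) (X x)
    - 2 * g x (nabla x Y Nbot) (X x)
    + 2 * g x (nabla x (X x) Ntop) Y
    + (n%:R - 2) * g x (nabla x (N x) X) Y.
Proof.
move=> N Ntop Nbot Hsigma Hperp tau taut.
have [oU Ux] := hU; have [UX SX] := hX; have tY : tangent x Y by case: hY.
have tX : tangent x (X x) by case: UX => + _; exact.
have UE i : vector_field U (E i) by have [/(_ i)[]] := hE.
have UEt i : vector_field U (Et i) by have [/(_ i)[]] := hEt.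
have hgt := conformal_riemannian hg hmu.
have hF := split_frame_orthonormal hg hsigma he he'.
set F := split_frame (e := e) (e' := e') in hF.
have tF k : tangent x (F k x) := frame_tangent hF k Ux.
have tE i : tangent x (E i x) := frame_tangent hE i Ux.
have tEt i : tangent x (Et i x) := frame_tangent hEt i Ux.
have tauE : g x (tau x) Y = \sum_k tension_form (g := g) (sigma := sigma)
    (D := nabla) x X Y (F k x) (F k).
  rewrite /tau /vertical_tension (tension_pair hg oU hsigma he he' hnabla)//.
  rewrite (tension_form_trace hg oU hsigma he he' hnabla Ux UX hY
    (lambda := 1) UE) ?mul1r// => k.
  rewrite scale1r [RHS](orthonormal_decomp hg hE Ux (tF k)).
  by apply: eq_bigr => i _; rewrite (metricC hg).
have tautE : expR (2 * mu x) * g x (taut x) Y =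
    \sum_k tension_form (g := g) (sigma := sigma)
    (D := nablat) x X Y (F k x) (F k).
  rewrite /taut /vertical_tension perp_conformal !ortho_proj_conformal.
  rewrite (tension_pair hg oU hsigma he he' hnablat)//.
  (* [Et] is orthonormal for [exp(2 mu) g], so its completeness relation written with [g] has the
     factor [exp(-2 mu)], which the exponential on the left of the theorem cancels. *)
  rewrite (tension_form_trace hg oU hsigma he he' hnablat Ux UX hY
    (lambda := expR (- (2 * mu x))) UEt); last first.
    move=> k; rewrite -/F [in RHS](orthonormal_decomp hgt hEt Ux (tF k)) scaler_sumr.
    apply: eq_bigr => i _; rewrite scalerA mulrA -expRD addNr expR0 mul1r.
    by rewrite (metricC hg).
  by rewrite mulrA -expRD subrr expR0 mul1r.
rewrite tautE tauE.
rewrite (conformal_tension_sum hg oU hmu hnabla hnablat hsigma he he' Ux hX hY).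
have -> : n%:R = (p + q)%:R :> R by rewrite -hpq.
by rewrite /N !(gradientE hg hF Ux).
Qed.
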